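(* Let $\beta>0$. Let $\xi_\beta$ be the unique point in $[0,1]$ which realizes the maximum on $[0,1]$ of $$\varphi_I(x):=\log(\cosh(\beta x))-\frac{\beta}{2}x^2 .$$ For $b\in\mathbb{R}$ let $\widetilde{\mu}_b$ be the dynamical Gibbs measure for the potential $b(\mathbf{1}_{[+1]}-\mathbf{1}_{[-1]})$ on $\Sigma_2=\{-1,+1\}^{\mathbb{N}}$. Then, as $n\to+\infty$, the probabilistic Gibbs measures $\mu_{n,\beta}$ of the Curie-Weiss model converge weakly: $$\mu_{n,\beta}\xrightarrow[n\to+\infty]{w}\begin{cases}\widetilde{\mu}_0 & \text{if } \beta\le 1,\\[4pt] \dfrac12\left[\widetilde{\mu}_{\beta\xi_\beta}+\widetilde{\mu}_{-\beta\xi_\beta}\right] & \text{if } \beta>1.\end{cases}$$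
   Context: Setting: $\Sigma_2=\{-1,+1\}^{\mathbb{N}}$ is the set of infinite sequences $x=x_0x_1x_2\ldots$ with $x_i\in\{-1,+1\}$, with the metric $d(x,y)=2^{-\min\{n:\ x_n\ne y_n\}}$ (for $x\neq y$) and the shift $\sigma(x_0x_1x_2\ldots)=x_1x_2\ldots$. For a finite word $w=w_0\ldots w_{n-1}$, the cylinder $[w]$ is the set of $y\in\Sigma_2$ with $y_i=w_i$ for $0\le i\le n-1$. So $\mathbf{1}_{[+1]}-\mathbf{1}_{[-1]}$ is the function $x\mapsto x_0$. Dynamical Gibbs measure: for a Lipschitz function $\phi:\Sigma_2\to\mathbb{R}$, the pressure is $\mathcal{P}(\phi)=\sup_\mu\{h_\mu+\int\phi\,d\mu\}$, the supremum being over $\sigma$-invariant Borel probability measures $\mu$, where $h_\mu$ is the Kolmogorov-Sinai entropy. There is a unique measure attaining the supremum (the equilibrium state), and it is called the dynamical Gibbs measure for $\phi$. Curie-Weiss model: for $\omega\in\Sigma_2$ (or a word of length $\ge n$), $H_n(\omega)=-\frac{1}{2n}\sum_{i,j=0}^{n-1}\omega_i\omega_j$. Let $\mathbb{P}=\rho^{\otimes\mathbb{N}}$ with $\rho(\{1\})=\rho(\{-1\})=\frac12$. The probabilistic Gibbs measure $\mu_{n,\beta}$ on $\Sigma_2$ is $$\mu_{n,\beta}(d\omega)=\frac{e^{-\beta H_n(\omega)}}{Z_{n,\beta}}\,\mathbb{P}(d\omega),\qquad Z_{n,\beta}=\frac{1}{2^n}\sum_{\omega'\in\{-1,1\}^n}e^{-\beta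 H_n(\omega')}.$$ Weak convergence $P_n\xrightarrow{w}P$ means $\int f\,dP_n\to\int f\,dP$ for every bounded continuous real function $f$. *)

(* Defs.v *)
From HB Require Import structures.
From mathcomp Require Import all_boot all_order all_algebra.
From mathcomp Require Import all_classical all_reals all_analysis.
From mathcomp Require Import measurable_realfun.

Set Implicit Arguments.
Unset Strict Implicit.
Unset Printing Implicit Defensive.

Import Order.TTheory GRing.Theory Num.Theory.
Import numFieldNormedType.Exports.

Local Open Scope classical_set_scope.
Local Open Scope ring_scope.

(* The letters +1 and -1 are encoded by [true] and [false]; [R] is a phantom
   parameter that fixes the field in which the distance takes its values. *)
Definition Sigma2 (R : realType) : Type := nat -> bool.

Definition spin {R : realType} (a : bool) : R := if a then 1 else -1.

Definition shift {R : realType} (x : Sigma2 R) : Sigma2 R := fun n => x n.+1.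

Definition cylinder {R : realType} n (w : n.-tuple bool) : set (Sigma2 R) :=
  [set y | forall i : 'I_n, y i = tnth w i].

Definition Sigma2_dist {R : realType} (x y : Sigma2 R) : R :=
  if pselect (exists n, x n != y n) is left xy then 2 ^- ex_minn xy else 0.

Section Sigma2_topology.
Variable R : realType.
Implicit Types x y z : Sigma2 R.

HB.instance Definition _ := Choice.copy (Sigma2 R) (nat -> bool).

Lemma Sigma2_dist_le x y n :
  (Sigma2_dist x y <= 2 ^- n :> R) <-> (forall i, (i < n)%N -> x i = y i).
Proof.
rewrite /Sigma2_dist; case: pselect => [xy|nxy]; last first.
  split=> _; last by rewrite invr_ge0 exprn_ge0.
  by move=> i _; apply/eqP/negPn/negP => ?; apply: nxy; exists i.
case: ex_minnP => m xym min.
rewrite lef_pV2 ?posrE ?exprn_gt0// ler_eXn2l ?ltr1n//.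
split=> [nm i ilt|h].
  apply/eqP/negPn/negP => /min; apply/negP; rewrite -ltnNge.
  exact: leq_trans nm.
by rewrite leqNgt; apply/negP => /h/eqP; apply/negP.
Qed.

Let distxx x : Sigma2_dist x x = 0.
Proof.
by rewrite /Sigma2_dist; case: pselect => // xx; exfalso; case: xx => n; rewrite eqxx.
Qed.

Let dist_pos x y : Sigma2_dist x y = 0 -> x = y.
Proof.
rewrite /Sigma2_dist; case: pselect => [xy /eqP|nxy _].
  by rewrite invr_eq0 expf_eq0 pnatr_eq0 andbF.
by apply/funext => n; apply/eqP/negPn/negP => ?; apply: nxy; exists n.
Qed.

Let dist_ge0 x y : 0 <= Sigma2_dist x y.
Proof.
by rewrite /Sigma2_dist; case: pselect => // ?; rewrite invr_ge0 exprn_ge0.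
Qed.

Let dist_sym x y : Sigma2_dist x y = Sigma2_dist y x.
Proof.
have le (a b : Sigma2 R) : Sigma2_dist a b <= Sigma2_dist b a.
  rewrite [leRHS]/Sigma2_dist; case: pselect => [h|h].
    apply: (Sigma2_dist_le a b (ex_minn h)).2 => i; case: ex_minnP => m _ min im.
    apply/eqP/negPn/negP; rewrite eq_sym => /min.
    by rewrite leqNgt im.
  suff -> : a = b by rewrite distxx.
  by apply/funext => n; apply/eqP/negPn/negP; rewrite eq_sym => ?; apply: h; exists n.
by apply/eqP; rewrite eq_le !le.
Qed.

Let dist_triangle y x z :
  Sigma2_dist x z <= Sigma2_dist x y + Sigma2_dist y z.
Proof.
rewrite {1}/Sigma2_dist; case: pselect => [h|h]; last exact: addr_ge0.
case: ex_minnP => m xzm _.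
have [xym|xym] := eqVneq (x m) (y m).
- apply: ler_wpDl => //; rewrite /Sigma2_dist; case: pselect => [h'|[]]; last first.
    by exists m; rewrite -xym.
  case: ex_minnP => k _ /(_ m); rewrite -xym => /(_ xzm) km.
  by rewrite lef_pV2 ?posrE ?exprn_gt0// ler_eXn2l ?ltr1n.
- apply: ler_wpDr => //; rewrite /Sigma2_dist; case: pselect => [h'|[]]; last first.
    by exists m.
  case: ex_minnP => k _ /(_ m xym) km.
  by rewrite lef_pV2 ?posrE ?exprn_gt0// ler_eXn2l ?ltr1n.
Qed.

HB.instance Definition _ := isMetric.Build R (Sigma2 R)
  distxx dist_pos dist_sym dist_triangle.

HB.instance Definition _ := isPointed.Build (Sigma2 R) (fun=> true).

(* The Borel sigma-algebra. *)
HB.instance Definition _ := @isMeasurable.Build (sigma_display (@open (Sigma2 R)))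
  (Sigma2 R) <<s @open (Sigma2 R) >> (@sigma_algebra0 _ setT _)
  (@sigma_algebraC _ _) (@sigma_algebra_bigcup _ setT _).

Lemma measurable_coord n : measurable_fun setT (fun x : Sigma2 R => x n).
Proof.
apply: (@measurable_fun_bool _ _ _ _ true); rewrite setTI.
suff : open [set x : Sigma2 R | x n = true] by exact: sub_sigma_algebra.
rewrite openE => x /= xn.
apply/nbhs_ballP; exists (2 ^- n.+1) => /=; first by rewrite invr_gt0 exprn_gt0.
move=> y /= /ltW.
by move=> /Sigma2_dist_le/(_ n (ltnSn n)) <-.
Qed.

End Sigma2_topology.

Section entropy.
Context d (T : measurableType d) (R : realType).
Implicit Types (mu : probability T R) (S : T -> T).

Definition invariant_measure S mu : Prop :=
  forall A, measurable A -> mu (S @^-1` A) = mu A.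

(* A finite measurable partition is given by a labelling [xi : T -> I] whose
   fibres, possibly empty, are the atoms. Since [ln 0 = 0], null atoms do not
   contribute. *)
Definition partition_entropy mu (I : finType) (xi : T -> I) : R :=
  - \sum_(i : I) fine (mu (xi @^-1` [set i])) * ln (fine (mu (xi @^-1` [set i]))).

(* The join of the [n] partitions [S^-i xi], [0 <= i < n]. *)
Definition partition_join S (I : finType) (xi : T -> I) n : T -> n.-tuple I :=
  fun x => [tuple xi (iter i S x) | i < n].

(* For an invariant measure the limit exists by subadditivity. *)
Definition entropy_rate S mu (I : finType) (xi : T -> I) : R :=
  limn (fun n => partition_entropy mu (partition_join S xi n) / n%:R).

Definition ks_entropy S mu : \bar R :=
  ereal_sup [set e | exists k (xi : T -> 'I_k),
    (forall i, measurable (xi @^-1` [set i])) /\ e = (entropy_rate S mu xi)%:E].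

Definition free_energy S (phi : T -> R) mu : \bar R :=
  (ks_entropy S mu + \int[mu]_x (phi x)%:E)%E.

Definition pressure S (phi : T -> R) : \bar R :=
  ereal_sup [set free_energy S phi mu | mu in invariant_measure S].

Definition equilibrium_state S (phi : T -> R) mu : Prop :=
  invariant_measure S mu /\ free_energy S phi mu = pressure S phi.

End entropy.

(* Lipschitz potentials have exactly one such measure, up to its values on
   non-measurable sets. *)
Definition dynamical_gibbs {R : realType} (phi : Sigma2 R -> R)
    (mu : probability (Sigma2 R) R) : Prop :=
  equilibrium_state shift phi mu.

Definition spin_potential {R : realType} (b : R) (x : Sigma2 R) : R :=
  b * (\1_(cylinder [tuple true]) x - \1_(cylinder [tuple false]) x).

Lemma spin_potentialE {R : realType} (b : R) (x : Sigma2 R) :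
  spin_potential b x = b * spin (x 0).
Proof.
rewrite /spin_potential !indicE /spin.
have cylE a : (x \in @cylinder R 1 [tuple a]) = (x 0 == a).
  apply/idP/eqP => [|xa]; first by rewrite inE => /(_ ord0).
  by rewrite inE => i; rewrite ord1.
by rewrite !cylE; case: (x 0) => /=; rewrite ?subr0 ?sub0r.
Qed.

Lemma spin_potential_lipschitz {R : realType} (b : R) (x y : Sigma2 R) :
  `|spin_potential b x - spin_potential b y| <= 2 * `|b| * mdist x y.
Proof.
rewrite !spin_potentialE -mulrBr normrM -mulrA [leRHS]mulrCA ler_wpM2l//.
have [->|xy] := eqVneq (x 0) (y 0); first by rewrite subrr normr0 mulr_ge0// mdist_ge0.
have -> : mdist x y = 1.
  rewrite /mdist/= /Sigma2_dist; case: pselect => [h|[]]; last by exists 0.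
  by case: ex_minnP => m _ /(_ _ xy); rewrite leqn0 => /eqP ->; rewrite expr0 invr1.
rewrite mulr1 (le_trans (ler_normB _ _))// /spin.
by case: (x 0); case: (y 0); rewrite ?normrN normr1.
Qed.

(* [P] is the product of countably many copies of [rho]: the unique measure with
   the expected value on each box that constrains finitely many coordinates. *)
Definition is_power_measure {R : realType} (rho : probability bool R)
    (P : probability (Sigma2 R) R) : Prop :=
  forall n (A : 'I_n -> set bool),
    P [set x : Sigma2 R | forall i : 'I_n, A i (x i)] = (\prod_(i < n) rho (A i))%E.

Definition fair_coin (R : realType) : probability bool R := bernoulli_prob 2^-1.

(* For [n = 0] the inverse is [0], hence the energy is [0]. *)
Definition cw_energy {R : realType} n (s : 'I_n -> bool) : R :=
  - (2 * n%:R)^-1 * \sum_(i < n) \sum_(j < n) spin (s i) * spin (s j).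

Definition cw_partition {R : realType} (beta : R) n : R :=
  (2 ^+ n)^-1 * \sum_(w : n.-tuple bool) expR (- beta * cw_energy (tnth w)).

Definition cw_density {R : realType} (beta : R) n (x : Sigma2 R) : R :=
  expR (- beta * cw_energy (fun i : 'I_n => x i)) / cw_partition beta n.

Definition cw_gibbs {R : realType} (P : probability (Sigma2 R) R) (beta : R) n :
    set (Sigma2 R) -> \bar R :=
  fun A => (\int[P]_(x in A) (cw_density beta n x)%:E)%E.

Section cw_gibbs_measure.
Context (R : realType) (P : probability (Sigma2 R) R) (beta : R) (n : nat).

Let density_ge0 x : 0 <= cw_density beta n x.
Proof.
rewrite divr_ge0 ?expR_ge0// mulr_ge0 ?invr_ge0 ?exprn_ge0//.
by apply: sumr_ge0 => w _; rewrite expR_ge0.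
Qed.

Lemma measurable_cw_density : measurable_fun setT (@cw_density R beta n).
Proof.
have mspin i : measurable_fun setT (fun x : Sigma2 R => spin (x i) : R).
  by apply: measurable_fun_ifT => //; exact: measurable_coord.
apply: measurable_funM => //; apply: measurableT_comp => //.
apply: measurable_funM => //; apply: measurable_funM => //.
apply: measurable_sum => i; apply: measurable_sum => j.
exact: measurable_funM.
Qed.

Let cw_gibbs0 : cw_gibbs P beta n set0 = 0%E.
Proof. by rewrite /cw_gibbs integral_set0. Qed.

Let cw_gibbs_ge0 A : (0 <= cw_gibbs P beta n A)%E.
Proof. by apply: integral_ge0 => x _; rewrite lee_fin. Qed.

Let cw_gibbs_sigma_additive : semi_sigma_additive (cw_gibbs P beta n).
Proof.
move=> F mF tF mUF; rewrite /cw_gibbs ge0_integral_bigcup//=.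
- apply: is_cvg_ereal_nneg_natsum_cond => k _ _.
  by apply: integral_ge0 => x _; rewrite lee_fin.
- apply/measurable_EFinP; apply: measurable_funTS.
  exact: measurable_cw_density.
- by move=> x _; rewrite lee_fin.
Qed.

HB.instance Definition _ := isMeasure.Build _ _ _ (cw_gibbs P beta n)
  cw_gibbs0 cw_gibbs_ge0 cw_gibbs_sigma_additive.

End cw_gibbs_measure.

Definition weak_cvg {R : realType}
    (mu_ : nat -> {measure set (Sigma2 R) -> \bar R})
    (mu : {measure set (Sigma2 R) -> \bar R}) : Prop :=
  forall f : Sigma2 R -> R, continuous f -> bounded_fun f ->
    (\int[mu_ n]_x (f x)%:E @[n --> \oo] --> \int[mu]_x (f x)%:E)%E.

Definition cosh {R : realType} (x : R) : R := (expR x + expR (- x)) / 2.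

Definition phi_I {R : realType} (beta x : R) : R :=
  ln (cosh (beta * x)) - beta / 2 * x ^+ 2.

Definition is_maximizer {R : realType} (D : set R) (f : R -> R) (x : R) : Prop :=
  D x /\ forall y, D y -> f y <= f x.

(* Main.v *)
Require Import Defs.
From mathcomp Require Import all_boot all_order all_algebra.
From mathcomp Require Import all_classical all_reals all_analysis.
From mathcomp Require Import measurable_realfun.
From mathcomp Require Import ring lra.

Import Order.TTheory GRing.Theory Num.Theory.
Import numFieldNormedType.Exports.

Set Implicit Arguments.
Unset Strict Implicit.
Unset Printing Implicit Defensive.

Local Open Scope classical_set_scope.
Local Open Scope ring_scope.

(* The equilibrium state for [b x_0] is the Bernoulli measure with weights
   [e^{+-b} / (e^b + e^-b)]: the entropy [h_mu] is at most [H_mu(k coordinates) / k]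
   for every [k], and [H_mu(k coordinates) + int S_k phi <= k ln (e^b + e^-b)] by
   the Gibbs inequality, whose equality case determines all cylinders. The bound
   is attained, since the Bernoulli measure exists.

   On the Curie-Weiss side, the Gaussian identity
   [e^(beta S^2 / 2n) = c_n int e^(- n beta y^2 / 2) e^(beta y S) dy] linearizes the
   square. After summing over words, [mu_n] of a cylinder becomes the average of
   its Bernoulli weight with parameter [beta y] against the density proportional
   to [e^(n phi_I(y))], which concentrates on the maximizers [+-xi] of [phi_I].
   Convergence on cylinders gives weak convergence because continuous functions
   on the Cantor space are uniformly continuous. *)

(** * Entropy of finite labellings *)

(** [ks_entropy] is a supremum over all finite measurable partitions, so the bound by [k]
    coordinates is the generator half of the Kolmogorov-Sinai theorem: an arbitrary labelling must
    be approximated in measure by functions of finitely many coordinates, and the errors must have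
    vanishing entropy per unit of time. The lower bound is easier: for the Bernoulli measure the
    partition by the first letter already attains the value. An equilibrium state is then squeezed
    to equality at every length separately, which fixes its cylinders with no uniqueness theorem as
    input. For [beta > 1] the Laplace density may have two peaks. Rather than dividing the mass
    between them, the Gaussian identity is averaged over both signs of the field; the observable
    becomes even, takes one value at both peaks, and a single concentration lemma suffices. This
    averaging is the source of the weights 1/2. *)

Section gibbs_inequality.
Context {R : realType}.
Implicit Types p q : R.

(** This is [ln t <= t - 1] at [t = q / p], strict away from [t = 1]. The implication
    [0 < p -> 0 < q] excludes the case where the convention [ln 0 = 0] could falsify the bound. *)
Lemma gibbs_term p q : 0 <= p -> 0 <= q -> (0 < p -> 0 < q) ->
  p - q <= p * ln p - p * ln q ?= iff (p == q).
Proof.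
move=> p0 q0 pq; move: (p0); rewrite le_eqVlt => /predU1P[<-|pp].
  by rewrite !mul0r subr0 sub0r; split; rewrite ?oppr_le0// oppr_eq0 eq_sym.
have qp := pq pp.
have -> : p * ln p - p * ln q = - (p * ln (q / p)).
  by rewrite ln_div ?posrE//; ring.
have -> : p - q = - (p * (q / p - 1)) by field; rewrite gt_eqF.
have lnE (x : R) : 0 < x -> ln x <= x - 1 ?= iff (x == 1).
  move=> x0; split; first by rewrite -[x in ln x](subrK 1) addrC le_ln1Dx// ltrBrDl subrr.
  apply/eqP/eqP => [|->]; last by rewrite ln1 subrr.
  apply: contraPP => /eqP x1.
  have := @expR_gt1Dx R (x - 1); rewrite subr_eq0 => /(_ x1).
  by rewrite addrC subrK => + lx; rewrite -lx lnK ?posrE// ltxx.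
have [le eq] := lnE _ (divr_gt0 qp pp).
split; first by rewrite lerN2 ler_pM2l.
have p_neq0 : p != 0 by rewrite gt_eqF.
rewrite eqr_opp (inj_eq (mulfI p_neq0)) eq_sym eq.
by rewrite -(inj_eq (mulIf p_neq0)) divfK// mul1r eq_sym.
Qed.

Lemma gibbs_inequality (I : finType) (p q : I -> R) :
  (forall i, 0 <= p i) -> (forall i, 0 <= q i) ->
  (forall i, 0 < p i -> 0 < q i) -> \sum_i p i = \sum_i q i ->
  \sum_i p i * ln (q i) <= \sum_i p i * ln (p i) ?= iff [forall i, p i == q i].
Proof.
move=> p0 q0 pq pqE.
have [le eq] : \sum_i (p i - q i) <= \sum_i (p i * ln (p i) - p i * ln (q i))
    ?= iff [forall i, p i == q i].
  exact: (@leif_sum _ _ xpredT _ _ _ (fun i _ => gibbs_term (p0 i) (q0 i) (@pq i))).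
move: le eq; rewrite !sumrB pqE subrr subr_ge0 [in LHS]eq_sym subr_eq0 => le eq.
by split => //; rewrite eq_sym.
Qed.

(** With [s = sqrt p] the left side is [2 s^2 (- ln s)], and [- ln s < 1 / s]. The bound vanishes at
    0 and controls the rare symbols of the error process below. *)
Lemma oppr_mul_ln_le_sqrt p : 0 <= p -> - (p * ln p) <= 2 * Num.sqrt p.
Proof.
rewrite le_eqVlt => /predU1P[<-|p0]; first by rewrite mul0r oppr0 mulr_ge0// sqrtr_ge0.
have s0 : 0 < Num.sqrt p by rewrite sqrtr_gt0.
rewrite -{1 2}(sqr_sqrtr (ltW p0)) lnXn//.
set s := Num.sqrt p in s0 *.
have := @ln_sublinear R s^-1; rewrite invr_gt0 => /(_ s0).
rewrite lnV ?posrE// => h.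
rewrite (_ : - _ = 2 * (s * (s * - ln s))); last by rewrite mulr2n; ring.
rewrite ler_pM2l// ger_pMr//.
by rewrite -(@mulfV _ s) ?gt_eqF// ler_pM2l// ltW.
Qed.

(** Comparison with [q = 1] in [gibbs_term] gives a bound that vanishes at [p = 1], as needed for
    the dominant symbol. *)
Lemma oppr_mul_ln_le_onem p : 0 <= p -> - (p * ln p) <= 1 - p.
Proof.
rewrite le_eqVlt => /predU1P[<-|p0]; first by rewrite mul0r oppr0 addr0 ler01.
have [le _] := @gibbs_term p 1 (ltW p0) ler01 (fun=> ltr01).
by move: le; rewrite ln1 mulr0 subr0 -lerN2 opprB.
Qed.

End gibbs_inequality.

Section finite_labelling.
Context d (T : measurableType d) (R : realType).
Implicit Types (mu : probability T R) (S : T -> T) (I J : finType).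

Definition measurable_fibers (I : Type) (X : T -> I) : Prop :=
  forall i, measurable (X @^-1` [set i]).

Definition law mu (I : Type) (X : T -> I) (i : I) : R := fine (mu (X @^-1` [set i])).

Lemma law_ge0 mu (I : Type) (X : T -> I) i : 0 <= law mu X i.
Proof. exact: fine_ge0. Qed.

Lemma preimage_comp_fibers (J : finType) (I : Type) (X : T -> J) (f : J -> I) (A : set I) :
  (f \o X) @^-1` A = \bigcup_(j in f @^-1` A) (X @^-1` [set j]).
Proof.
by apply/seteqP; split => [x /= fx|x [j fj /= ->]//]; exists (X x).
Qed.

Lemma measurable_preimage_fibers J (X : T -> J) (A : set J) :
  measurable_fibers X -> measurable (X @^-1` A).
Proof.
move=> mX; rewrite (preimage_comp_fibers X id).
exact: fin_bigcup_measurable.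
Qed.

Lemma measurable_fibers_comp J (I : Type) (X : T -> J) (f : J -> I) :
  measurable_fibers X -> measurable_fibers (f \o X).
Proof. by move=> mX i; rewrite comp_preimage; exact: measurable_preimage_fibers. Qed.

Lemma measure_preimage_fibers mu J (X : T -> J) (A : set J) :
  measurable_fibers X -> fine (mu (X @^-1` A)) = \sum_(j | j \in A) law mu X j.
Proof.
move=> mX; rewrite (preimage_comp_fibers X id) preimage_id measure_fin_bigcup//; last 2 first.
- exact: finite_finset.
- by move=> i j _ _ [x [/= <- <-]].
rewrite (fsbigE [seq j <- index_enum J | j \in A])/=; first last.
- by move=> j Aj; rewrite mem_filter mem_index_enum mem_set.
- by move=> j; rewrite /= mem_filter => /andP[/set_mem].
- by rewrite filter_uniq// index_enum_uniq.
rewrite big_filter_cond -sum_fine => [|j _]; last exact: fin_num_measure.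
by apply: eq_bigl => j; rewrite andbb.
Qed.

Lemma sum_law mu J (X : T -> J) : measurable_fibers X -> \sum_j law mu X j = 1.
Proof.
move=> mX; have := @measure_preimage_fibers mu J X setT mX.
by rewrite preimage_setT probability_setT/= => ->; apply: eq_bigl => j; rewrite mem_set.
Qed.

Lemma law_comp mu J I (X : T -> J) (f : J -> I) i : measurable_fibers X ->
  law mu (f \o X) i = \sum_(j | f j == i) law mu X j.
Proof.
move=> mX; rewrite /law comp_preimage measure_preimage_fibers//.
by apply: eq_bigl => j; apply/idP/eqP => [/set_mem|/mem_set].
Qed.

Lemma le_law_comp mu J I (X : T -> J) (f : J -> I) j : measurable_fibers X ->
  law mu X j <= law mu (f \o X) (f j).
Proof.
move=> mX; rewrite law_comp// (bigD1 j)//= lerDl sumr_ge0// => k _.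
exact: law_ge0.
Qed.

Lemma sum_law_comp mu J I (X : T -> J) (f : J -> I) (g : I -> R) : measurable_fibers X ->
  \sum_i law mu (f \o X) i * g i = \sum_j law mu X j * g (f j).
Proof.
move=> mX; rewrite [RHS](partition_big f xpredT)//=; apply: eq_bigr => i _.
by rewrite law_comp// mulr_suml; apply: eq_bigr => j /eqP ->.
Qed.

Lemma partition_entropyE mu I (X : T -> I) :
  partition_entropy mu X = - \sum_i law mu X i * ln (law mu X i).
Proof. by []. Qed.

Lemma partition_entropy_ge0 mu J (X : T -> J) : measurable_fibers X ->
  0 <= partition_entropy mu X.
Proof.
move=> mX; rewrite partition_entropyE oppr_ge0 sumr_le0// => j _.
rewrite mulr_ge0_le0 ?law_ge0// ln_le0// -(sum_law mu mX) (bigD1 j)//= lerDl.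
by rewrite sumr_ge0// => i _; exact: law_ge0.
Qed.

(** Each atom of [X] lies in its merged atom, so after indexing both sums by [J] the logarithms
    compare term by term. *)
Lemma partition_entropy_comp mu J I (X : T -> J) (f : J -> I) : measurable_fibers X ->
  partition_entropy mu (f \o X) <= partition_entropy mu X.
Proof.
move=> mX; rewrite !partition_entropyE lerN2 sum_law_comp// ler_sum// => j _.
have := law_ge0 mu X j; rewrite le_eqVlt => /predU1P[<-|p0]; first by rewrite !mul0r.
by rewrite ler_pM2l// ler_ln ?posrE ?(lt_le_trans p0)// le_law_comp.
Qed.

(** Gibbs inequality against the product of the marginals; where the joint law is positive so are
    both marginals, and the logarithm of the product splits. *)
Lemma partition_entropy_pair mu I J (X : T -> I) (Y : T -> J) :
  measurable_fibers X -> measurable_fibers Y ->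
  measurable_fibers (fun x => (X x, Y x)) /\
  partition_entropy mu (fun x => (X x, Y x)) <=
    partition_entropy mu X + partition_entropy mu Y.
Proof.
move=> mX mY; set Z := fun x => (X x, Y x).
have mZ : measurable_fibers Z.
  move=> [i j]; rewrite (_ : _ @^-1` _ = X @^-1` [set i] `&` Y @^-1` [set j]).
    exact: measurableI.
  apply/seteqP; split => x; rewrite /Z /=; first by move=> [-> ->].
  by move=> [-> ->].
split => //; rewrite !partition_entropyE -opprD lerN2.
have -> : X = fst \o Z by []. have -> : Y = snd \o Z by [].
rewrite !sum_law_comp// -big_split/=.
have pX k := le_law_comp mu fst k mZ; have pY k := le_law_comp mu snd k mZ.
set pr := fun k => law mu (fst \o Z) k.1 * law mu (snd \o Z) k.2.
have pos k : 0 < law mu Z k -> 0 < law mu (fst \o Z) k.1 /\ 0 < law mu (snd \o Z) k.2.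
  by move=> k0; split; apply: (lt_le_trans k0).
have [| | | |le _] := @gibbs_inequality R _ (law mu Z) pr.
- by move=> k; exact: law_ge0.
- by move=> k; rewrite mulr_ge0 ?law_ge0.
- by move=> k /pos[? ?]; rewrite mulr_gt0.
- rewrite sum_law// -(pair_bigA _ (fun i j => law mu (fst \o Z) i * law mu (snd \o Z) j))/=.
  rewrite -[LHS](mulr1 1) -{1}(sum_law mu mX) -(sum_law mu mY) mulr_suml.
  by apply: eq_bigr => i _; rewrite mulr_sumr.
- apply: le_trans le; apply: ler_sum => k _; rewrite -mulrDr.
  have := law_ge0 mu Z k; rewrite le_eqVlt => /predU1P[<-|k0]; first by rewrite !mul0r.
  by have [? ?] := pos _ k0; rewrite /pr lnM ?posrE.
Qed.

Lemma invariant_preimage mu S (mS : measurable_fun setT S) n :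
  invariant_measure S mu -> measurable_fun setT (iter n S) /\ invariant_measure (iter n S) mu.
Proof.
move=> iS; elim: n => [|n [mn iN]].
  split; first exact: measurable_id.
  by move=> A mA.
split; first exact: measurableT_comp.
move=> A mA; rewrite -[RHS]iS// -[RHS]iN//.
by rewrite -[_ @^-1` _]setTI; exact: mS.
Qed.

Lemma partition_entropy_invariant mu S I (X : T -> I) : measurable_fun setT S ->
  invariant_measure S mu -> measurable_fibers X ->
  measurable_fibers (X \o S) /\ partition_entropy mu (X \o S) = partition_entropy mu X.
Proof.
move=> mS iS mX; split.
  by move=> i; rewrite comp_preimage -[_ @^-1` _]setTI; exact: mS.
by rewrite !partition_entropyE /law; under eq_bigr do rewrite comp_preimage iS//.
Qed.

Lemma partition_entropy_join mu S I (X : T -> I) n : measurable_fun setT S ->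
  invariant_measure S mu -> measurable_fibers X ->
  measurable_fibers (partition_join S X n) /\
  partition_entropy mu (partition_join S X n) <= n%:R * partition_entropy mu X.
Proof.
move=> mS iS mX; elim: n => [|n [mn IHn]].
  have E : partition_join S X 0 = cst [tuple].
    by apply/funext => x; exact: tuple0.
  rewrite E; split.
    by move=> t; rewrite (preimage_comp_fibers (cst tt) (fun=> [tuple])); apply: fin_bigcup_measurable => // -[] _; rewrite preimage_cst; case: ifP.
  rewrite mul0r partition_entropyE oppr_le0 sumr_ge0// => t _.
  by rewrite /law (_ : _ @^-1` _ = setT) ?probability_setT/= ?ln1 ?mulr0//; apply/seteqP; split => // x _; rewrite /= [t]tuple0.
have [mSn iSn] := invariant_preimage mS n iS.
have [mXn eXn] := partition_entropy_invariant mSn iSn mX.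
have [mp ep] := partition_entropy_pair mu mn mXn.
pose f (z : n.-tuple I * I) : n.+1.-tuple I := [tuple of rcons z.1 z.2].
have -> : partition_join S X n.+1 = f \o (fun x => (partition_join S X n x, (X \o iter n S) x)).
  apply/funext => x; apply: val_inj => /=.
  by rewrite enum_ordSr map_rcons -map_comp.
split; first exact: measurable_fibers_comp.
rewrite (le_trans (partition_entropy_comp _ _ mp))// (le_trans ep)// eXn mulrSr mulrDl mul1r.
by rewrite lerD2r.
Qed.

(** [None] contributes at most its missing mass [eps]; any other symbol has mass at most [eps] and
    contributes at most [2 sqrt eps]. *)
Lemma partition_entropy_option mu I (e : T -> option I) (eps : R) : measurable_fibers e ->
  fine (mu (e @^-1` [set~ None])) <= eps ->
  partition_entropy mu e <= eps + 2 * #|{: option I}|%:R * Num.sqrt eps.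
Proof.
move=> me muE.
have massE : fine (mu (e @^-1` [set~ None])) = \sum_(j | j != None) law mu e j.
  rewrite measure_preimage_fibers//; apply: eq_bigl => j.
  by apply/idP/idP => [/set_mem jN|/eqP jN]; [exact/eqP|exact/mem_set].
rewrite massE in muE.
rewrite partition_entropyE (bigD1 None)//= opprD lerD//.
  rewrite (le_trans (oppr_mul_ln_le_onem (law_ge0 _ _ _)))//.
  by rewrite -(sum_law mu me) (bigD1 None)//= addrAC subrr add0r.
rewrite -sumrN (@le_trans _ _ (\sum_(j : option I | j != None) 2 * Num.sqrt eps))//.
  apply: ler_sum => j jN; rewrite (le_trans (oppr_mul_ln_le_sqrt (law_ge0 _ _ _)))//.
  rewrite ler_pM2l// ler_wsqrtr// (le_trans _ muE)// (bigD1 j)//= lerDl.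
  by apply: sumr_ge0 => i _; exact: law_ge0.
rewrite sumr_const -[leLHS]mulr_natr [leLHS]mulrAC ler_wpM2r ?sqrtr_ge0// ler_pM2l//.
by rewrite ler_nat max_card.
Qed.

(** Letter [i] of the name is letter [i %% k] of block [i %/ k], and by invariance under [iter k S]
    all blocks have the same entropy. The successor pays for the last, incomplete block. *)
Lemma partition_join_blocks mu S J (a : T -> J) k n : measurable_fun setT S ->
  invariant_measure S mu -> measurable_fibers a -> (0 < k)%N ->
  partition_entropy mu (partition_join S a n) <=
    (n %/ k).+1%:R * partition_entropy mu (partition_join S a k).
Proof.
move=> mS iS ma k0.
have [mak _] := partition_entropy_join k mS iS ma.
have [mSk iSk] := invariant_preimage mS k iS.
have [mj ej] := partition_entropy_join (n %/ k).+1 mSk iSk mak.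
have divlt (i : 'I_n) : (i %/ k < (n %/ k).+1)%N by rewrite ltnS leq_div2r// ltnW.
have modlt (i : 'I_n) : (i %% k < k)%N by rewrite ltn_mod.
pose f (t : (n %/ k).+1.-tuple (k.-tuple J)) : n.-tuple J :=
  [tuple tnth (tnth t (Ordinal (divlt i))) (Ordinal (modlt i)) | i < n].
rewrite (le_trans _ ej)//.
have -> : partition_join S a n = f \o partition_join (iter k S) (partition_join S a k) (n %/ k).+1.
  apply/funext => x; apply: eq_from_tnth => i; rewrite /f !tnth_mktuple.
  by rewrite -iterM -iterD addnC -divn_eq.
exact: partition_entropy_comp.
Qed.

(* The [xi]-name of a point is recovered from its [a]-name together with the
   errors of the approximation [f]; the error process is almost always [None]
   and so has small entropy. This replaces conditional entropies in the proof of
   the Kolmogorov-Sinai theorem below. *)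
Lemma partition_entropy_join_approx mu S I J (xi : T -> I) (a : T -> J) m
    (f : m.-tuple J -> I) (eps : R) n : measurable_fun setT S ->
  invariant_measure S mu -> measurable_fibers a -> measurable_fibers xi ->
  fine (mu [set x | xi x != f (partition_join S a m x)]) <= eps ->
  partition_entropy mu (partition_join S xi n) <=
    partition_entropy mu (partition_join S a (n + m)) +
    n%:R * (eps + 2 * #|{: option I}|%:R * Num.sqrt eps).
Proof.
move=> mS iS ma mxi muE.
pose am := partition_join S a m.
have [mam _] := partition_entropy_join m mS iS ma.
have [mZ _] := partition_entropy_pair mu mxi mam.
pose err (z : I * m.-tuple J) := if z.1 == f z.2 then None else Some z.1.
pose e := err \o (fun x => (xi x, am x)).
have me : measurable_fibers e by exact: measurable_fibers_comp.
have He : partition_entropy mu e <= eps + 2 * #|{: option I}|%:R * Num.sqrt eps.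
  apply: partition_entropy_option => //; rewrite (le_trans _ muE)//.
  rewrite le_eqVlt; apply/orP; left; apply/eqP; congr (fine (mu _)).
  by apply/seteqP; split => x; rewrite /e /err /am /=; case: eqP.
have [men en] := partition_entropy_join n mS iS me.
have [maN _] := partition_entropy_join (n + m) mS iS ma.
have [mP eP] := partition_entropy_pair mu maN men.
(* Decoding position [i < n] may read the letters [i, ..., i + m - 1], hence a name of length
   [n + m]. *)
have addlt (i : 'I_n) (j : 'I_m) : (i + j < n + m)%N by rewrite -addnS leq_add// ltnW.
pose g (z : (n + m).-tuple J * n.-tuple (option I)) : n.-tuple I :=
  [tuple if tnth z.2 i is Some y then y
         else f [tuple tnth z.1 (Ordinal (addlt i j)) | j < m] | i < n].
have -> : partition_join S xi n = g \o (fun x => (partition_join S a (n + m) x, partition_join S e n x)).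
  apply/funext => x; apply: eq_from_tnth => i; rewrite /g !tnth_mktuple /e /err /=.
  case: eqP => // ->; congr f; apply: eq_from_tnth => j; rewrite !tnth_mktuple/=.
  by rewrite -iterD addnC.
rewrite (le_trans (partition_entropy_comp _ _ mP))// (le_trans eP)// lerD2l.
by rewrite (le_trans en)// ler_wpM2l.
Qed.

(** The window [m] and the tolerance [eps] are fixed before [n] grows, so after division by [n] only
    the block entropy per letter and the small per-letter cost of the errors remain. *)
Lemma ks_entropy_le mu S J (a : T -> J) k : measurable_fun setT S ->
  invariant_measure S mu -> measurable_fibers a -> (0 < k)%N ->
  (forall r (xi : T -> 'I_r), measurable_fibers xi -> forall eps : R, 0 < eps ->
    exists m (f : m.-tuple J -> 'I_r),
      fine (mu [set x | xi x != f (partition_join S a m x)]) <= eps) ->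
  (ks_entropy S mu <= (partition_entropy mu (partition_join S a k) / k%:R)%:E)%E.
Proof.
move=> mS iS ma k0 approx; apply: ge_ereal_sup => _ [r [xi [mxi ->]]].
rewrite lee_fin /entropy_rate.
set H := partition_entropy mu _; set u := fun n => _.
have [mak _] := partition_entropy_join k mS iS ma.
have H0 : 0 <= H by exact: partition_entropy_ge0.
have kR : (0 : R) < k%:R by rewrite ltr0n.
(* A divergent [limn] is [0], which is harmless for an upper bound. *)
have [cu|/dvgP ->] := pselect (cvgn u); last by rewrite divr_ge0.
apply/ler_addgt0Pr => delta delta0.
set c : R := 2 * #|{: option 'I_r}|%:R.
have c0 : 0 <= c by rewrite mulr_ge0.
(* Both [eps] and [c * sqrt eps] become at most [delta / 4]; the [+ 1] keeps the denominator
   positive from [0 <= c] alone. *)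
pose eps := Num.min (delta / 4) ((delta / 4 / (c + 1)) ^+ 2).
have eps0 : 0 < eps by rewrite lt_min divr_gt0//= exprn_gt0// !divr_gt0// ltr_wpDl.
have [m [f muE]] := approx r xi mxi eps eps0.
have errle : eps + c * Num.sqrt eps <= delta / 2.
  rewrite (_ : delta / 2 = delta / 4 + delta / 4); last by field.
  rewrite lerD ?ge_min ?lexx//.
  rewrite (@le_trans _ _ ((c + 1) * Num.sqrt eps))//.
    by rewrite ler_wpM2r ?sqrtr_ge0// lerDl.
  rewrite mulrC -ler_pdivlMr ?ltr_wpDl// (@le_trans _ _ (Num.sqrt ((delta / 4 / (c + 1)) ^+ 2)))//.
    by rewrite ler_wsqrtr// ge_min lexx orbT.
  by rewrite sqrtr_sqr ger0_norm// !divr_ge0 ?addr_ge0// ltW.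
apply: limr_le => //.
near=> n.
have n0 : (0 : R) < n%:R by rewrite ltr0n; near: n; exact: nbhs_infty_gt.
rewrite /u ler_pdivrMr//.
rewrite (le_trans (partition_entropy_join_approx n mS iS ma mxi muE))//.
have mulle : n%:R * (eps + c * Num.sqrt eps) <= n%:R * (delta / 2) by rewrite ler_wpM2l// ltW.
have Hn := partition_join_blocks (n + m) mS iS ma k0.
have divle : ((n + m) %/ k)%:R <= (n%:R + m%:R) / k%:R :> R.
  by rewrite ler_pdivlMr// -natrD -natrM ler_nat leq_trunc_div.
(* The [m] extra letters and the incomplete block cost a constant independent of [n]. *)
have nlarge : (m%:R / k%:R + 1) * H <= n%:R * (delta / 2).
  rewrite -ler_pdivrMr ?divr_gt0//; near: n; exact: nbhs_infty_ger.
rewrite (le_trans (lerD Hn mulle))//.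
rewrite (@le_trans _ _ (((n%:R + m%:R) / k%:R + 1) * H + n%:R * (delta / 2)))//.
  by rewrite lerD2r ler_wpM2r// -natr1 lerD2r.
rewrite (_ : _ * H = H / k%:R * n%:R + (m%:R / k%:R + 1) * H); last first.
  by rewrite /H; field; rewrite gt_eqF.
rewrite [leRHS]mulrDl -[leLHS]addrA lerD2l (_ : delta * n%:R = n%:R * (delta / 2) + n%:R * (delta / 2)); last by field.
by rewrite lerD2r.
Unshelve. all: by end_near.
Qed.

End finite_labelling.

Section finite_labelling_integral.
Context d (T : measurableType d) (R : realType).
Implicit Types (I J : finType).

Lemma measurable_fibers_tuple (I : Type) n (X : 'I_n -> T -> I) :
  (forall i, measurable_fibers (X i)) ->
  measurable_fibers (fun x => [tuple X i x | i < n]).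
Proof.
move=> mX t.
rewrite (_ : _ @^-1` _ = \bigcap_(i in [set: 'I_n]) X i @^-1` [set tnth t i]).
  by apply: fin_bigcap_measurable => // i _; exact: mX.
apply/seteqP; split => x /=; first by move=> <- i _; rewrite /= tnth_mktuple.
by move=> h; apply: eq_from_tnth => i; rewrite tnth_mktuple h.
Qed.

Lemma integral_labelling (mu : {measure set T -> \bar R}) J (X : T -> J) (g : J -> R) :
  (mu setT < +oo)%E -> measurable_fibers X ->
  (\int[mu]_x (g (X x))%:E = \sum_j (g j)%:E * mu (X @^-1` [set j]))%E.
Proof.
move=> muoo mX.
have iI j : mu.-integrable [set: T] (fun x : T => (\1_(X @^-1` [set j]) x)%:E).
  apply: (@measurable_bounded_integrable _ _ _ mu (\1_(X @^-1` [set j]))) => //.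
  exists 1; split => // M M1 x _; rewrite /= ger0_norm// (le_trans _ (ltW M1))//.
have -> : (fun x => (g (X x))%:E) = (fun x => \sum_j ((g j)%:E * (\1_(X @^-1` [set j]) x)%:E))%E.
  apply/funext => x; rewrite (bigD1 (X x))//= indicE mem_set// mule1 big1 ?adde0// => j.
  move=> jX; rewrite indicE memNset ?mule0// => /= Xj; by rewrite Xj eqxx in jX.
rewrite integral_sum//=; last by move=> j; exact: integrableZl.
apply: eq_bigr => j _; rewrite integralZl//.
by rewrite integral_indic// setIT.
Qed.

Lemma measurable_labelling J (X : T -> J) (g : J -> R) :
  measurable_fibers X -> measurable_fun setT (g \o X).
Proof.
move=> mX _ A mA; rewrite setTI comp_preimage.
exact: measurable_preimage_fibers.
Qed.

End finite_labelling_integral.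

Lemma content_subadditive_fin d (T : ringOfSetsType d) (R : realType)
    (mu : {measure set T -> \bar R}) n (A : set T) (B : 'I_n -> set T) :
  measurable A -> (forall i, measurable (B i)) -> A `<=` \bigcup_i B i ->
  (mu A <= \sum_(i < n) mu (B i))%E.
Proof.
move=> mA mB AB; pose B' (k : nat) := if insub k is Some i then B i else set0.
have B'E (i : 'I_n) : B' i = B i by rewrite /B' valK.
under eq_bigr do rewrite -B'E.
apply: (content_subadditive mu) => //.
  by move=> k _; rewrite /B'; case: insubP.
move=> x /AB[i _ Bix]; rewrite -bigcup_mkord; exists i => //=.
by rewrite B'E.
Qed.

(** * The Cantor space *)

Section Sigma2.
Context {R : realType}.
Implicit Types (x y : Sigma2 R) (A : set (Sigma2 R)) (mu : probability (Sigma2 R) R).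

Definition coords n x : n.-tuple bool := [tuple x i | i < n].

Lemma cylinderE n (w : n.-tuple bool) : cylinder w = coords n @^-1` [set w].
Proof.
apply/seteqP; split => x /= h; last by move=> i; rewrite -h tnth_mktuple.
by apply: eq_from_tnth => i; rewrite tnth_mktuple h.
Qed.

Lemma eq_coords n x y : coords n x = coords n y <-> forall i, (i < n)%N -> x i = y i.
Proof.
split=> [h i ilt|h]; last by apply: eq_from_tnth => i; rewrite !tnth_mktuple h.
by have := congr1 (fun t => tnth t (Ordinal ilt)) h; rewrite !tnth_mktuple.
Qed.

Lemma measurable_fibers_coord n : measurable_fibers (fun x => x n).
Proof.
move=> b; rewrite -[_ @^-1` _]setTI; exact: measurable_coord.
Qed.

Lemma measurable_coords n : measurable_fibers (coords n).
Proof. by apply: measurable_fibers_tuple => i; exact: measurable_fibers_coord. Qed.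

Lemma ball_coords x y n (e : R) : 2 ^- n < e -> coords n x = coords n y -> ball x e y.
Proof. by move=> ne /eq_coords/Sigma2_dist_le; rewrite /ball/= => /le_lt_trans; exact. Qed.

Lemma exp2N_lt (e : R) : 0 < e -> exists n, 2 ^- n < e.
Proof.
move=> e0; exists (Num.truncn e^-1).+1.
rewrite -[ltRHS]invrK ltf_pV2 ?posrE ?exprn_gt0 ?invr_gt0//.
rewrite (lt_trans (truncnS_gt _))// -natrX ltr_nat; exact: ltn_expl.
Qed.

Lemma open_coords (U : set (Sigma2 R)) : open U ->
  U = \bigcup_n coords n @^-1` [set w | cylinder w `<=` U].
Proof.
rewrite openE => oU; apply/seteqP; split => [x Ux|x [n _ /=]]; last first.
  by apply; rewrite cylinderE.
have /nbhs_ballP[e /= e0 eU] := oU x Ux.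
have [n ne] := exp2N_lt e0.
exists n => //= y; rewrite cylinderE/= => yx; apply: eU.
exact: ball_coords ne (esym yx).
Qed.

(** This algebra generates the Borel sets. It serves as a pi-system for uniqueness of measures and
    as a dense class for approximation in measure. *)
Definition coord_sets : set (set (Sigma2 R)) :=
  [set A | exists n (D : set (n.-tuple bool)), A = coords n @^-1` D].

Definition word_prefix n m (nm : (n <= m)%N) (w : m.-tuple bool) : n.-tuple bool :=
  [tuple tnth w (widen_ord nm i) | i < n].

Lemma word_prefix_coords n m (nm : (n <= m)%N) : word_prefix nm \o coords m = coords n.
Proof. by apply/funext => x; apply: eq_from_tnth => i; rewrite !tnth_mktuple. Qed.

Lemma coords_lift n m (D : set (n.-tuple bool)) : (n <= m)%N ->
  exists D' : set (m.-tuple bool), coords n @^-1` D = coords m @^-1` D'.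
Proof.
by move=> nm; exists (word_prefix nm @^-1` D); rewrite -comp_preimage word_prefix_coords.
Qed.

Lemma coord_setsI : setI_closed coord_sets.
Proof.
move=> A B [n [D ->]] [m [E ->]].
have [D' ->] := coords_lift D (leq_maxl n m).
have [E' ->] := coords_lift E (leq_maxr n m).
by exists (maxn n m), (D' `&` E').
Qed.

Lemma coord_setsC A : coord_sets A -> coord_sets (~` A).
Proof. by move=> [n [D ->]]; exists n, (~` D). Qed.

Lemma coord_sets_measurable A : coord_sets A -> measurable A.
Proof.
by move=> [n [D ->]]; apply: measurable_preimage_fibers; exact: measurable_coords.
Qed.

Lemma Sigma2_measurableE : @measurable _ (Sigma2 R) = <<s coord_sets >>.
Proof.
apply/seteqP; split.
  apply: smallest_sub; first exact: smallest_sigma_algebra.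
  move=> U /open_coords ->; apply: sigma_algebra_bigcup => n.
  by apply: sub_sigma_algebra; exists n; eexists.
apply: smallest_sub; first exact: sigma_algebra_measurable.
exact: coord_sets_measurable.
Qed.

Lemma measurable_fun_Sigma2 d (T : measurableType d) (f : T -> Sigma2 R) :
  (forall n, measurable_fibers (fun t => f t n)) -> measurable_fun setT f.
Proof.
move=> mf; apply: (measurability _ Sigma2_measurableE) => _ [_ [n [D ->]] <-].
rewrite setTI -comp_preimage; apply: measurable_preimage_fibers.
by apply: measurable_fibers_tuple => i; exact: mf.
Qed.

Lemma measurable_shift : measurable_fun setT (@Defs.shift R).
Proof. by apply: measurable_fun_Sigma2 => n; exact: measurable_fibers_coord. Qed.

Lemma measure_Sigma2_unique (m1 m2 : {measure set (Sigma2 R) -> \bar R}) :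
  (m1 setT < +oo)%E ->
  (forall n w, m1 (coords n @^-1` [set w]) = m2 (coords n @^-1` [set w])) ->
  forall A, measurable A -> m1 A = m2 A.
Proof.
move=> m1oo m12; apply: (measure_unique coord_sets (fun=> setT)) => //.
- exact: Sigma2_measurableE.
- exact: coord_setsI.
- by move=> _; exists 0, setT.
- by apply/seteqP; split => // x _; exists 0.
move=> _ [n [D ->]]; rewrite (preimage_comp_fibers (coords n) id) preimage_id.
rewrite !measure_fin_bigcup ?m12//.
all: try exact: finite_finset.
all: try by move=> i j _ _ [x [/= <- <-]].
all: try by move=> w _; exact: measurable_coords.
by apply: eq_fsbigr => w _; exact: m12.
Qed.

Definition sym_diff (A B : set (Sigma2 R)) := (A `\` B) `|` (B `\` A).

Lemma measurable_sym_diff A B : measurable A -> measurable B -> measurable (sym_diff A B).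
Proof. by move=> mA mB; apply: measurableU; exact: measurableD. Qed.

(** Measurability is part of the notion so that induction over the generated sigma-algebra supplies
    it for the members of a union. *)
Definition approximable mu A := measurable A /\
  forall eps : R, 0 < eps -> exists2 C, coord_sets C & (mu (sym_diff A C) <= eps%:E)%E.

Lemma approximableU mu A B : approximable mu A -> approximable mu B -> approximable mu (A `|` B).
Proof.
move=> [mA aA] [mB aB]; split=> [|eps eps0]; first exact: measurableU.
have eps20 : 0 < eps / 2 by rewrite divr_gt0.
have [C cC AC] := aA _ eps20; have [D cD BD] := aB _ eps20.
have mC := coord_sets_measurable cC; have mD := coord_sets_measurable cD.
exists (C `|` D).
  rewrite -[_ `|` _]setCK setCU; apply: coord_setsC.
  by apply: coord_setsI; exact: coord_setsC.
rewrite (@le_trans _ _ (mu (sym_diff A C `|` sym_diff B D)))//.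
  apply: le_measure; rewrite ?inE.
  - by apply: measurable_sym_diff; exact: measurableU.
  - by apply: measurableU; exact: measurable_sym_diff.
  - by move=> x; rewrite /sym_diff /=; tauto.
rewrite (le_trans (measureU2 _ _ _))//; [exact: measurable_sym_diff..|].
by rewrite (splitr eps) EFinD leeD.
Qed.

(** The approximable sets form a sigma-algebra containing the coordinate sets. For a countable
    union, half of [eps] pays for truncation to a finite union, by continuity from below, and half
    for approximating the latter. *)
Lemma measurable_approximable mu A : measurable A -> approximable mu A.
Proof.
rewrite Sigma2_measurableE.
have coord_appr B : coord_sets B -> approximable mu B.
  move=> cB; split=> [|eps eps0]; first exact: coord_sets_measurable.
  by exists B => //; rewrite /sym_diff setDv setU0 measure0 lee_fin ltW.
apply: (@smallest_sub _ _ coord_sets (approximable mu)) => //; split.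
- by apply: coord_appr; exists 0, set0.
- move=> B [mB aB]; rewrite setTD; split=> [|eps eps0]; first exact: measurableC.
  have [C cC BC] := aB _ eps0; exists (~` C); first exact: coord_setsC.
  rewrite (_ : sym_diff _ _ = sym_diff B C)//.
  by rewrite /sym_diff !setDE !setCK setUC setIC [X in _ `|` X]setIC.
move=> F aF; split; first by apply: bigcup_measurable => k _; have [] := aF k.
have aN n : approximable mu (\big[setU/set0]_(i < n) F i).
  elim: n => [|n IHn]; last by rewrite big_ord_recr/=; exact: approximableU.
  by rewrite big_ord0; apply: coord_appr; exists 0, set0.
set B := \bigcup_k F k; move=> eps eps0.
have mB : measurable B by apply: bigcup_measurable => k _; have [] := aF k.
pose G n := \big[setU/set0]_(i < n) F i.
have GB : \bigcup_n G n = B.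
  apply/seteqP; split => x.
    by move=> [n _]; rewrite /G -bigcup_mkord => -[k _ Fk]; exists k.
  by move=> [k _ Fk]; exists k.+1 => //; rewrite /G -bigcup_mkord; exists k => /=.
have ndG : nondecreasing_seq G.
  move=> n1 n2 n12; apply/subsetPset => x; rewrite /G -!bigcup_mkord => -[k /= kn Fk].
  by exists k => //=; exact: leq_trans n12.
have mG n : measurable (G n) by have [] := aN n.
have eps20 : 0 < eps / 2 by rewrite divr_gt0.
have [n muBG] : exists n, (mu (B `\` G n) <= (eps / 2)%:E)%E.
  have /fine_cvgP[_ cv] : (fun n => mu (G n)) @ \oo --> (fine (mu B))%:E.
    rewrite fineK ?fin_num_measure// -GB.
    by apply: nondecreasing_cvg_mu => //; rewrite GB.
  have /cvgrPdist_le/(_ _ eps20)[n _ /(_ n (leqnn n))] := cv.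
  rewrite /= => h; exists n.
  rewrite measureD ?ltey_eq ?fin_num_measure// setIidr; last by rewrite -GB; exact: bigcup_sup.
  rewrite -(fineK (fin_num_measure mu _ mB)) -(fineK (fin_num_measure mu _ (mG n))).
  by rewrite -EFinB lee_fin (le_trans (ler_norm _)).
have [C cC GC] := (aN n).2 _ eps20.
have mC := coord_sets_measurable cC.
exists C => //; rewrite (@le_trans _ _ (mu ((B `\` G n) `|` sym_diff (G n) C)))//.
  have GnB : G n `<=` B by rewrite -GB; exact: bigcup_sup.
  apply: le_measure; rewrite ?inE.
  - exact: measurable_sym_diff.
  - by apply: measurableU; [exact: measurableD|exact: measurable_sym_diff].
  - move=> x; have := GnB x; rewrite /sym_diff /=.
    by have [|] := pselect (G n x); tauto.
rewrite (le_trans (measureU2 _ _ _))//; [exact: measurableD|exact: measurable_sym_diff|].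
by rewrite (splitr eps) EFinD leeD.
Qed.

(** The first coordinate generates: approximate each atom within [eps / r], lift all approximations
    to a common length, and note that a mislabelled point lies in the symmetric difference of some
    atom with its approximation. *)
Lemma labelling_approx mu r (xi : Sigma2 R -> 'I_r) (eps : R) :
  measurable_fibers xi -> 0 < eps ->
  exists m (f : m.-tuple bool -> 'I_r), fine (mu [set x | xi x != f (coords m x)]) <= eps.
Proof.
move=> mxi eps0.
have r0 : (0 < r)%N by rewrite (leq_ltn_trans _ (ltn_ord (xi point))).
have eps' : 0 < eps / r%:R by rewrite divr_gt0// ltr0n.
have /choice[C CP] (i : 'I_r) : exists C, coord_sets C /\
    (mu (sym_diff (xi @^-1` [set i]) C) <= (eps / r%:R)%:E)%E.
  by have [C ? ?] := (measurable_approximable mu (mxi i)).2 _ eps'; exists C.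
have /choice[k kP] (i : 'I_r) : exists k : nat, exists D : set (k.-tuple bool), C i = coords k @^-1` D.
  by have [[k [D ?]] _] := CP i; exists k, D.
pose m := \max_(i < r) k i.
have /choice[D DP] (i : 'I_r) : exists D : set (m.-tuple bool), C i = coords m @^-1` D.
  by have [D ->] := kP i; apply: coords_lift; exact: (leq_bigmax i).
(* If several approximations contain [w], or none does, any label will do: the points concerned
   already lie in some symmetric difference. *)
pose f w := odflt (xi point) [pick i | `[< D i w >]].
have mdiff i : measurable (sym_diff (xi @^-1` [set i]) (C i)).
  by apply: measurable_sym_diff => //; apply: coord_sets_measurable; have [] := CP i.
have [mP _] := partition_entropy_pair mu mxi (@measurable_coords m).
have mE : measurable [set x | xi x != f (coords m x)].
  exact: (measurable_preimage_fibers [set z | z.1 != f z.2] mP).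
exists m, f; rewrite -lee_fin fineK ?fin_num_measure//.
apply: (@le_trans _ _ (\sum_(i < r) mu (sym_diff (xi @^-1` [set i]) (C i)))%E).
  apply: content_subadditive_fin => // x /= xf.
  apply: contrapT => xC.
  have xCE i : (xi x = i) <-> C i x.
    apply: contrapT => xi_C; apply: xC; exists i => //=; rewrite /sym_diff /=.
    by have [|] := pselect (xi x = i); have [|] := pselect (C i x); tauto.
  move/eqP: xf; apply; rewrite /f; case: pickP => [i /asboolP Di|/(_ (xi x)) /asboolP[]].
    by apply/xCE; rewrite DP.
  by have /xCE := erefl (xi x); rewrite DP.
apply: (@le_trans _ _ (\sum_(i < r) (eps / r%:R)%:E)%E).
  by apply: lee_sum => i _; have [] := CP i.
by rewrite sumEFin lee_fin sumr_const card_ord -[leLHS]mulr_natr divfK// pnatr_eq0 -lt0n.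
Qed.

End Sigma2.

(** * From convergence on cylinders to weak convergence *)

Section weak_convergence.
Context {R : realType}.
Implicit Types (x y : Sigma2 R) (f : Sigma2 R -> R).

Definition agree n x y := forall i, (i < n)%N -> x i = y i.

Lemma continuous_nbhs_agree f x (eps : R) : continuous f -> 0 < eps ->
  exists n, forall y, agree n x y -> `|f x - f y| <= eps.
Proof.
move=> cf eps0; have /cvgrPdist_le/(_ _ eps0)/nbhs_ballP[e /= e0 fe] := cf x.
have [n ne] := exp2N_lt e0; exists n => y xy; apply: fe.
by apply: ball_coords ne _; apply/eq_coords.
Qed.

(* Compactness of the Cantor space: a word whose cylinder contains no scale of
   [eps]-constancy has a one-letter extension with the same defect, and the
   resulting infinite path is a point of discontinuity. *)
Lemma uniformly_continuous_Sigma2 f (eps : R) : continuous f -> 0 < eps ->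
  exists n, forall x y, agree n x y -> `|f x - f y| <= eps.
Proof.
move=> cf eps0.
pose good n x := exists k, forall y z,
  agree n x y -> agree n x z -> agree k y z -> `|f y - f z| <= eps.
have [[k kP]|bad0] := pselect (good 0 point).
  by exists k => x y; exact: kP.
exfalso.
pose upd n b x : Sigma2 R := fun i => if i == n then b else x i.
have goodS n x : good n.+1 (upd n true x) -> good n.+1 (upd n false x) -> good n x.
  move=> [k1 k1P] [k2 k2P]; exists (maxn n.+1 (maxn k1 k2)) => y z xy xz yz.
  have yz1 : agree k1 y z by move=> i ik; apply: yz; rewrite !leq_max ik orbT.
  have yz2 : agree k2 y z by move=> i ik; apply: yz; rewrite !leq_max ik !orbT.
  have yzn : y n = z n by apply: yz; rewrite leq_max ltnSn.
  have updP t : agree n x t -> agree n.+1 (upd n (t n) x) t.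
    move=> xt i; rewrite ltnS leq_eqVlt /upd => /predU1P[->|ilt]; first by rewrite eqxx.
    by rewrite (ltn_eqF ilt) xt.
  have := updP _ xy; have := updP _ xz; rewrite -yzn.
  by case: (y n) => ? ?; [exact: k1P|exact: k2P].
pose next n x := if pselect (good n.+1 (upd n true x)) then upd n false x else upd n true x.
pose path := fix path n := if n is n'.+1 then next n' (path n') else (point : Sigma2 R).
have bad n : ~ good n (path n).
  elim: n => // n IHn /=; rewrite /next; case: pselect => // g1 g2.
  by apply: IHn; exact: goodS.
(* Diagonal sequence: passing from [path n] to [path n.+1] changes at most letter [n], which is
   final from then on. *)
pose lim : Sigma2 R := fun n => path n.+1 n.
have pathE n m i : (i < n)%N -> path (n + m)%N i = path n i.
  move=> ilt; elim: m => [|m <-]; first by rewrite addn0.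
  rewrite addnS /= /next /upd; case: pselect => _ //=; by rewrite ltn_eqF// ltn_addr.
have [n nP] := continuous_nbhs_agree lim cf (divr_gt0 eps0 (ltr0n _ 2)).
(* By continuity at [lim], [f] stays within [eps / 2] of [f lim] on the whole cylinder of [path n],
   so scale 0 already witnesses [good]. *)
apply: (bad n); exists 0 => y z py pz _.
have limP t : agree n (path n) t -> agree n lim t.
  by move=> pt i ilt; rewrite -pt// /lim -(subnKC ilt) pathE.
rewrite (le_trans (ler_distD (f lim) _ _))// [leRHS](splitr eps) lerD//.
  by rewrite distrC; exact/nP/limP.
exact/nP/limP.
Qed.

Lemma continuous_measurable_Sigma2 f : continuous f -> measurable_fun setT f.
Proof.
move=> /continuousP cf; apply: (measurability _ (RGenOpens.measurableE R)).
move=> _ [_ [a [b ->] <-]]; rewrite setTI; apply: sub_sigma_algebra.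
by apply: cf; exact: interval_open.
Qed.

Lemma bounded_integrable_Sigma2 (m : {measure set (Sigma2 R) -> \bar R}) f :
  m setT = 1%E -> continuous f -> bounded_fun f -> m.-integrable setT (EFin \o f).
Proof.
move=> m1 cf bf; apply: measurable_bounded_integrable => //.
- by rewrite m1 ltey.
- exact: continuous_measurable_Sigma2.
Qed.

(** [nth true w] pads the word with letters [true] into a point of its cylinder; the step function
    so obtained is uniformly [eps]-close to [f], and the total mass is 1. *)
Lemma integral_coords_approx (m : {measure set (Sigma2 R) -> \bar R}) f n (eps : R) :
  m setT = 1%E -> continuous f -> bounded_fun f ->
  (forall x y, agree n x y -> `|f x - f y| <= eps) ->
  `|fine (\int[m]_x (f x)%:E) -
    \sum_(w : n.-tuple bool) f (nth true w) * fine (m (coords n @^-1` [set w]))| <= eps.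
Proof.
move=> m1 cf bf fn.
have moo : (m setT < +oo)%E by rewrite m1 ltey.
have mfin w : m (coords n @^-1` [set w]) \is a fin_num.
  rewrite ge0_fin_numE// (le_lt_trans _ moo)// le_measure ?inE//.
  exact: measurable_coords.
have fi := bounded_integrable_Sigma2 m1 cf bf.
set g : Sigma2 R -> R := fun x => f (nth true (coords n x)).
have gi : m.-integrable setT (EFin \o g).
  apply: measurable_bounded_integrable => //.
    exact: (measurable_labelling (fun w : n.-tuple bool => f (nth true w)) (@measurable_coords _ n)).
  have [M [Mr fM]] := bf; exists M; split => // r Mr' x _; exact: fM.
have -> : \sum_(w : n.-tuple bool) f (nth true w) * fine (m (coords n @^-1` [set w])) =
    \int[m]_x g x.
  rewrite /Rintegral (integral_labelling (fun w : n.-tuple bool => f (nth true w)) moo (@measurable_coords _ n)).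
  rewrite -sum_fine => [|w _]; last by rewrite fin_numM.
  by apply: eq_bigr => w _; rewrite fineM.
rewrite -[X in X - _]/(\int[m]_x f x) -RintegralB//.
have bi : m.-integrable setT (EFin \o (fun x => f x - g x)).
  by apply: (eq_integrable _ (fun x => (f x)%:E - (g x)%:E)%E) => //; exact: integrableB.
rewrite (le_trans (le_normr_Rintegral _ bi))//.
have -> : eps = \int[m]_x (cst eps x) by rewrite Rintegral_cst// m1 mulr1.
apply: le_Rintegral => //.
- exact: (integrable_abse bi).
- apply: measurable_bounded_integrable => //.
  by exists `|eps|; split => // r ltr x _; exact: ltW.
move=> x _; apply: fn => i ilt.
by rewrite (nth_map (Ordinal ilt)) ?size_enum_ord// nth_enum_ord.
Qed.

(** Uniform continuity gives one word length at which the cylinder sums approximate the integrals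
    for all measures at once; the rest is a three-term estimate. *)
Lemma weak_cvg_coords (m_ : nat -> {measure set (Sigma2 R) -> \bar R})
    (m : {measure set (Sigma2 R) -> \bar R}) :
  (forall n, m_ n setT = 1%E) -> m setT = 1%E ->
  (forall k (w : k.-tuple bool),
    fine (m_ n (coords k @^-1` [set w])) @[n --> \oo] --> fine (m (coords k @^-1` [set w]))) ->
  weak_cvg m_ m.
Proof.
move=> m_1 m1 mcvg f cf bf.
have finm (m' : {measure set (Sigma2 R) -> \bar R}) : m' setT = 1%E ->
    (\int[m']_x (f x)%:E)%E \is a fin_num.
  by move=> m'1; apply: integrable_fin_num => //; exact: bounded_integrable_Sigma2.
rewrite -(fineK (finm m m1)); apply/fine_cvgP; split.
  by apply: nearW => n; exact: finm.
apply/cvgrPdist_le => eps eps0.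
have eps30 : 0 < eps / 3 by rewrite divr_gt0.
have [k kP] := uniformly_continuous_Sigma2 cf eps30.
pose S (m' : {measure set (Sigma2 R) -> \bar R}) : R :=
  \sum_(w : k.-tuple bool) f (nth true w) * fine (m' (coords k @^-1` [set w])).
have Scvg : S (m_ n) @[n --> \oo] --> S m.
  apply: cvg_big => [|w _]; first exact: add_continuous.
  by apply: cvgM; [exact: cvg_cst|exact: mcvg].
have /cvgrPdist_le/(_ _ eps30) := Scvg.
apply: filterS => n Sn.
have h1 := integral_coords_approx m1 cf bf kP.
have h2 := integral_coords_approx (m_1 n) cf bf kP.
rewrite /= (le_trans (ler_distD (S m) _ _))//.
rewrite (_ : eps = eps / 3 + (eps / 3 + eps / 3)); last by field.
rewrite lerD// (le_trans (ler_distD (S (m_ n)) _ _))// lerD// distrC//.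
Qed.

End weak_convergence.

(** * Bernoulli measures and equilibrium states *)

Lemma pushforward_probability d d' (T : measurableType d) (T' : measurableType d')
    (R : realType) (P : probability T R) (f : T -> T') : measurable_fun setT f ->
  exists nu : probability T' R, forall A, nu A = P (f @^-1` A).
Proof. by move=> mf; exists (distribution P (mfun_Sub (mem_set mf))). Qed.

Section bernoulli_measure.
Context {R : realType}.
Variable p : R.
Hypothesis p01 : 0 < p < 1.

Definition letter_weight (b : bool) : R := if b then p else 1 - p.

(* Lebesgue measure on [0, 1[ is pushed to the Bernoulli measure by the
   itineraries of this two-branch expanding map. *)
Definition expand (x : R) : R := if x < p then x / p else (x - p) / (1 - p).

Definition itinerary (x : R) : Sigma2 R := fun n => iter n expand x < p.

Let p0 : 0 < p. Proof. by case/andP: p01. Qed.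
Let q0 : 0 < 1 - p. Proof. by case/andP: p01 => _; rewrite subr_gt0. Qed.

Lemma letter_weight_gt0 b : 0 < letter_weight b.
Proof. by case: b. Qed.

Lemma expand_itv x : 0 <= x < 1 -> 0 <= expand x < 1.
Proof.
move=> /andP[x0 x1]; rewrite /expand; case: ltP => xp.
  by rewrite divr_ge0 ?(ltW p0)//= ltr_pdivrMr// mul1r.
by rewrite divr_ge0 ?(ltW q0) ?subr_ge0//= ltr_pdivrMr// mul1r ltrD2r.
Qed.

(** Each branch of [expand] is affine onto the unit interval, so pulling an interval back through
    the branch of a letter multiplies its length by the weight of that letter. *)
Lemma itinerary_interval (w : seq bool) :
  exists l, [/\ 0 <= l, l + \prod_(a <- w) letter_weight a <= 1 &
    forall x, 0 <= x < 1 ->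
      (forall i, (i < size w)%N -> itinerary x i = nth true w i) <->
      l <= x < l + \prod_(a <- w) letter_weight a].
Proof.
elim: w => [|a w [l [l0 l1 lP]]].
  by exists 0; rewrite big_nil add0r; split => // x ->; split.
set m := \prod_(a <- w) letter_weight a in l1 lP *.
have m0 : 0 <= m by apply: prodr_ge0 => b _; exact/ltW/letter_weight_gt0.
have step x : 0 <= x < 1 ->
    (forall i, (i < size (a :: w))%N -> itinerary x i = nth true (a :: w) i) <->
    (x < p) = a /\ l <= expand x < l + m.
  move=> x01; rewrite -(lP _ (expand_itv x01)); split=> [h|[h1 h2] [//|i ilt]].
    split; first exact: (h 0).
    by move=> i ilt; have := h i.+1 ilt; rewrite /itinerary iterSr.
  by rewrite /itinerary iterSr; exact: h2.
rewrite big_cons -/m; case: a step => step /=.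
(* The left ends are images of [l] under the inverse branches: [p * l] here, [p + (1 - p) * l] for
   the other letter. *)
- exists (p * l); rewrite -mulrDr; split.
  + by rewrite mulr_ge0// ltW.
  + by rewrite mulr_ile1 ?addr_ge0// ltW//; case/andP: p01.
  + move=> x x01; rewrite step// /expand; case: ltP => xp.
      rewrite ler_pdivlMr// ltr_pdivrMr// ![_ * p]mulrC.
      by split => [[]|].
    split => [[]//|/andP[_ xlt]]; move: xp; rewrite leNgt => /negP[].
    by rewrite (lt_le_trans xlt)// ger_pMr.
- exists (p + (1 - p) * l); rewrite -addrA -mulrDr; split.
  + by rewrite addr_ge0 ?mulr_ge0// ltW.
  + by rewrite -lerBrDl ger_pMr.
  + move=> x x01; rewrite step// /expand; case: ltP => xp.
      split => [[]//|/andP[xge _]]; move: xp; rewrite ltNge => /negP[].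
      by rewrite (le_trans _ xge)// lerDl mulr_ge0// ltW.
    rewrite ler_pdivlMr// ltr_pdivrMr// ![_ * (1 - p)]mulrC -lerBrDl -ltrBlDl.
    by split => [[]|].
Qed.

Lemma measurable_itinerary : measurable_fun setT itinerary.
Proof.
have mexpand : measurable_fun setT expand.
  apply: measurable_fun_ifT => /=.
  - exact: measurable_fun_ltr.
  - exact: measurable_funM.
  - by apply: measurable_funM => //; exact: measurable_funB.
have miter n : measurable_fun setT (fun x => iter n expand x).
  by elim: n => [|n IHn] /=; [exact: measurable_id|exact: measurableT_comp mexpand IHn].
apply: measurable_fun_Sigma2 => n b; rewrite -[_ @^-1` _]setTI.
have := measurable_fun_ltr (miter n) (@measurable_cst _ _ _ _ setT p).
by apply.
Qed.

Lemma bernoulli_measure_exists : exists nu : probability (Sigma2 R) R,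
  forall n (w : n.-tuple bool),
    nu (coords n @^-1` [set w]) = (\prod_(a <- w) letter_weight a)%:E.
Proof.
pose I : set R := [set` `[0, 1[].
have mI : measurable I by exact: measurable_itv.
pose leb := mrestr (@lebesgue_measure R) mI : measure (measurableTypeR R) R.
have leb1 : leb setT = 1%E.
  by rewrite /leb /= /mrestr setTI lebesgue_measure_itv/= lte_fin ltr01 oppr0 adde0.
(* [leb] has mass 1, so normalizing leaves its values unchanged and only packages it as a
   probability. *)
pose P := mnormalize leb (dirac (0 : measurableTypeR R)) : probability (measurableTypeR R) R.
have [nu nuE] := pushforward_probability P (measurable_itinerary : measurable_fun [set: measurableTypeR R] _).
have PE A : mnormalize leb (dirac (0 : measurableTypeR R)) A = leb A.
  by rewrite /mnormalize leb1 onee_eq0/= invr1 mule1.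
exists nu => n w; rewrite nuE /P [LHS]PE.
have [l [l0 l1 lP]] := itinerary_interval w.
set m := \prod_(a <- w) _ in l1 lP *.
have m0 : 0 < m by apply: prodr_gt0 => b _; exact: letter_weight_gt0.
rewrite /leb /= /mrestr (_ : _ `&` I = [set` `[l, l + m[]).
  by rewrite lebesgue_measure_itv/= lte_fin ltrDl m0 -EFinB addrAC subrr add0r.
have coordsP x : coords n (itinerary x) = w <->
    forall i, (i < size w)%N -> itinerary x i = nth true w i.
  rewrite size_tuple; split => [<- i ilt|h].
    by rewrite (nth_map (Ordinal ilt)) ?size_enum_ord// nth_enum_ord.
  by apply: eq_from_tnth => i; rewrite tnth_mktuple h// (tnth_nth true).
apply/seteqP; split => x /=; rewrite !in_itv/=.
  by move=> [xw x01]; apply/lP => //; exact/coordsP.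
move=> xl; have x01 : 0 <= x < 1.
  by case/andP: xl => lx xm; rewrite (le_trans l0)//= (lt_le_trans xm).
by split => //; apply/coordsP/lP.
Qed.

End bernoulli_measure.

Section gibbs_words.
Context {R : realType}.
Implicit Types (b : R) (a : bool) (w : seq bool).

Definition gibbs_letter b a : R := expR (b * spin a) / (expR b + expR (- b)).

Definition gibbs_word b w : R := \prod_(a <- w) gibbs_letter b a.

Definition spin_sum w : R := \sum_(a <- w) spin a.

Lemma expRDexpRN_gt0 b : 0 < expR b + expR (- b).
Proof. by rewrite addr_gt0 ?expR_gt0. Qed.

Lemma gibbs_letter_gt0 b a : 0 < gibbs_letter b a.
Proof. by rewrite divr_gt0 ?expR_gt0 ?expRDexpRN_gt0. Qed.

Lemma gibbs_letterN b : gibbs_letter b false = 1 - gibbs_letter b true.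
Proof.
rewrite /gibbs_letter /spin mulr1 mulrN1.
by field; rewrite gt_eqF// expRDexpRN_gt0.
Qed.

Lemma gibbs_letter_itv b : 0 < gibbs_letter b true < 1.
Proof. by rewrite gibbs_letter_gt0 -subr_gt0 -gibbs_letterN gibbs_letter_gt0. Qed.

Lemma gibbs_letterE b a : letter_weight (gibbs_letter b true) a = gibbs_letter b a.
Proof. by case: a => //=; rewrite gibbs_letterN. Qed.

Lemma gibbs_word_gt0 b w : 0 < gibbs_word b w.
Proof. by apply: prodr_gt0 => a _; exact: gibbs_letter_gt0. Qed.

Lemma gibbs_wordE b w :
  gibbs_word b w = expR (b * spin_sum w) / (expR b + expR (- b)) ^+ size w.
Proof.
rewrite /gibbs_word /spin_sum; elim: w => [|a w IHw].
  by rewrite !big_nil mulr0 expR0 expr0 divr1.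
rewrite !big_cons IHw /gibbs_letter mulrDr expRD /= exprS invfM.
by rewrite -!mulrA; congr (_ * _); rewrite mulrCA.
Qed.

Lemma ln_gibbs_word b w :
  ln (gibbs_word b w) = b * spin_sum w - (size w)%:R * ln (expR b + expR (- b)).
Proof.
rewrite gibbs_wordE ln_div ?posrE ?expR_gt0 ?exprn_gt0 ?expRDexpRN_gt0//.
by rewrite expRK lnXn ?expRDexpRN_gt0// mulr_natl.
Qed.

End gibbs_words.

Section equilibrium.
Context {R : realType}.
Implicit Types (b : R) (mu : probability (Sigma2 R) R).

Local Notation shift := (@Defs.shift R).
Local Notation coord0 := (fun x : Sigma2 R => x 0%N).

Lemma coordsE n : partition_join shift coord0 n = coords n.
Proof.
apply/funext => x; apply: eq_from_tnth => i; rewrite !tnth_mktuple.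
have iterE (y : Sigma2 R) k : iter k shift y = (fun m => y (m + k)%N).
  elim: k => [|k IHk] /=; first by apply/funext => m; rewrite addn0.
  by rewrite IHk; apply/funext => m; rewrite /Defs.shift addSnnS.
by rewrite iterE add0n.
Qed.

Lemma integral_spin_potential b mu :
  (\int[mu]_x (spin_potential b x)%:E)%E =
  (\sum_a law mu coord0 a * (b * spin a))%:E.
Proof.
have muoo : (mu setT < +oo)%E by rewrite probability_setT ltey.
under eq_integral do rewrite spin_potentialE.
rewrite (integral_labelling (fun a => b * spin a) muoo (@measurable_fibers_coord _ 0%N)).
rewrite -sumEFin; apply: eq_bigr => a _.
rewrite muleC [RHS]EFinM /law fineK// fin_num_measure//.
exact: measurable_fibers_coord.
Qed.

(** By invariance every letter of the word has the law of letter 0. *)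
Lemma sum_law_spin_sum b mu n : invariant_measure shift mu ->
  \sum_(w : n.-tuple bool) law mu (coords n) w * (b * spin_sum w) =
  n%:R * \sum_a law mu coord0 a * (b * spin a).
Proof.
move=> imu.
transitivity (\sum_(w : n.-tuple bool) \sum_(i < n) law mu (coords n) w * (b * spin (tnth w i))).
  by apply: eq_bigr => w _; rewrite /spin_sum big_tuple !mulr_sumr.
rewrite exchange_big/= mulr_natl -[in RHS](card_ord n) -sumr_const; apply: eq_bigr => i _.
rewrite -(sum_law_comp mu (fun w => tnth w i) (fun a => b * spin a) (@measurable_coords _ n)).
apply: eq_bigr => a _; congr (_ * _).
have [mS iS] := invariant_preimage (@measurable_shift R) i imu.
have -> : (fun w => tnth w i) \o coords n = coord0 \o iter i shift.
  by apply/funext => x /=; rewrite -coordsE tnth_mktuple.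
by rewrite /law comp_preimage iS//; exact: measurable_fibers_coord.
Qed.

(** Since [ln (gibbs_word b w)] is affine in [spin_sum w], the cross term of the Gibbs inequality
    sees [mu] only through its one-letter law. The equality case serves twice: to compute the
    entropy of the Bernoulli measure and to identify equilibrium states. *)
Lemma entropy_coords_le b mu n : invariant_measure shift mu ->
  partition_entropy mu (coords n) <= n%:R *
    (ln (expR b + expR (- b)) - \sum_a law mu coord0 a * (b * spin a))
    ?= iff [forall w : n.-tuple bool, law mu (coords n) w == gibbs_word b w].
Proof.
move=> imu.
have sum_gibbs : \sum_(w : n.-tuple bool) gibbs_word b w = 1.
  have [nu nuE] := bernoulli_measure_exists (gibbs_letter_itv b).
  rewrite -(sum_law nu (@measurable_coords _ n)); apply: eq_bigr => w _.
  rewrite /law nuE/=; apply: eq_bigr => a _; exact/esym/gibbs_letterE.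
have [| | | |le eq] := @gibbs_inequality R _ (law mu (coords n)) (fun w => gibbs_word b w).
- by move=> w; exact: law_ge0.
- by move=> w; exact/ltW/gibbs_word_gt0.
- by move=> w _; exact: gibbs_word_gt0.
- by rewrite sum_law ?sum_gibbs//; exact: measurable_coords.
have E : \sum_(w : n.-tuple bool) law mu (coords n) w * ln (gibbs_word b w) = - (n%:R *
    (ln (expR b + expR (- b)) - \sum_a law mu coord0 a * (b * spin a))).
  under eq_bigr do rewrite ln_gibbs_word size_tuple mulrBr.
  rewrite sumrB sum_law_spin_sum// -mulr_suml sum_law ?mul1r; last exact: measurable_coords.
  by rewrite mulrBr opprB.
move: le eq; rewrite E partition_entropyE => le eq.
split; first by rewrite lerNl.
by rewrite eqr_oppLR eq_sym; exact: eq.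
Qed.

(** Summing over the letter that the shift forgets shows that the image measure has the same
    cylinder values, and these determine it. *)
Lemma bernoulli_invariant b : exists nu : probability (Sigma2 R) R,
  invariant_measure shift nu /\
  forall n (w : n.-tuple bool), law nu (coords n) w = gibbs_word b w.
Proof.
have [nu nuE] := bernoulli_measure_exists (gibbs_letter_itv b).
have nuE' n (w : n.-tuple bool) : nu (coords n @^-1` [set w]) = (gibbs_word b w)%:E.
  by rewrite nuE; congr (_%:E); apply: eq_bigr => a _; exact: gibbs_letterE.
exists nu; split; last by move=> n w; rewrite /law nuE'.
have [nu' nu'E] := pushforward_probability nu (@measurable_shift R).
move=> A mA; rewrite -nu'E; apply: (measure_Sigma2_unique (m1 := nu')) => //.
  by rewrite [X in (X < _)%E]probability_setT ltey.
move=> n w; transitivity ((gibbs_word b w)%:E); last exact/esym/nuE'.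
rewrite [LHS]nu'E.
have -> : shift @^-1` (coords n @^-1` [set w]) =
    coords n.+1 @^-1` [set [tuple of true :: w]] `|` coords n.+1 @^-1` [set [tuple of false :: w]].
  have coordsS x : val (coords n.+1 x) = x 0%N :: val (coords n (shift x)).
    by rewrite /= enum_ordSl /= -map_comp.
  apply/seteqP; split => x /=.
    move=> <-; case x0 : (x 0%N); [left|right]; apply: val_inj.
      by rewrite coordsS x0.
    by rewrite coordsS x0.
  by case=> /(congr1 val); rewrite coordsS /= => -[_ cw]; exact: val_inj.
rewrite measureU; first last.
- by apply/seteqP; split => // x [/= -> /(congr1 (fun t => thead t))].
- exact: measurable_coords.
- exact: measurable_coords.
rewrite [X in (X + _)%E]nuE' [X in (_ + X)%E]nuE' -EFinD; congr (_%:E).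
by rewrite /gibbs_word /= !big_cons -mulrDl gibbs_letterN addrC subrK mul1r.
Qed.

Lemma pressure_ge b : ((ln (expR b + expR (- b)))%:E <= pressure shift (spin_potential b))%E.
Proof.
have [nu [inu nuE]] := bernoulli_invariant b.
apply: (@le_trans _ _ (free_energy shift (spin_potential b) nu)); last first.
  by apply: ereal_sup_ubound; exists nu.
set I := \sum_a law nu coord0 a * (b * spin a).
have entE n : partition_entropy nu (coords n) = n%:R * (ln (expR b + expR (- b)) - I).
  have [_ eq] := entropy_coords_le b n inu.
  by apply/eqP; rewrite eq; apply/forallP => w; rewrite nuE.
(* [ks_entropy] takes labels in some ['I_k], so the first letter is recoded; names in either
   alphabet are functions of each other and have equal entropy. *)
pose f (a : bool) : 'I_2 := if a then ord_max else ord0.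
pose g (i : 'I_2) : bool := i != ord0.
have fK : cancel f g by case.
pose xi := f \o coord0.
have mxi : measurable_fibers xi.
  by apply: measurable_fibers_comp; exact: measurable_fibers_coord.
have xiE n : partition_join shift xi n = (fun w => [tuple f (tnth w i) | i < n]) \o coords n.
  by apply/funext => x; apply: eq_from_tnth => i; rewrite -coordsE !tnth_mktuple.
have coords_xi n : coords n = (fun w => [tuple g (tnth w i) | i < n]) \o partition_join shift xi n.
  by apply/funext => x; apply: eq_from_tnth => i; rewrite -coordsE !tnth_mktuple /= fK.
have xi_ent n : partition_entropy nu (partition_join shift xi n) = partition_entropy nu (coords n).
  apply/eqP; rewrite eq_le; apply/andP; split.
    by rewrite xiE; apply: partition_entropy_comp; exact: measurable_coords.
  rewrite {1}coords_xi; apply: partition_entropy_comp; rewrite xiE.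
  by apply: measurable_fibers_comp; exact: measurable_coords.
have rate : entropy_rate shift nu xi = ln (expR b + expR (- b)) - I.
  (* The quotient is constant only for [n > 0]: at [n = 0] division by zero gives 0. *)
  apply/cvg_lim => //; apply: cvg_near_cst; near=> n.
  rewrite xi_ent entE mulrC mulKf// pnatr_eq0 -lt0n; near: n; exact: nbhs_infty_gt.
rewrite /free_energy integral_spin_potential -/I -[X in (X%:E <= _)%E](subrK I) EFinD leeD2r//.
by apply: ereal_sup_ubound; exists 2, xi; split => //; rewrite rate.
Unshelve. all: by end_near.
Qed.

(** Maximality, [pressure_ge], and [ks_entropy_le] with block length [n] reverse the inequality of
    [entropy_coords_le]; its equality case then gives every word of length [n]. *)
Lemma dynamical_gibbs_coords b mu n (w : n.-tuple bool) :
  dynamical_gibbs (spin_potential b) mu ->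
  fine (mu (coords n @^-1` [set w])) = gibbs_word b w.
Proof.
move=> [imu mueq].
have [le eq] := entropy_coords_le b n imu.
suff : n%:R * (ln (expR b + expR (- b)) - \sum_a law mu coord0 a * (b * spin a))
    <= partition_entropy mu (coords n).
  move=> ge; have := eq; rewrite eq_le le ge => /esym/forallP/(_ w)/eqP; exact.
have [->|n0] := posnP n.
  by rewrite mul0r partition_entropy_ge0//; exact: measurable_coords.
have := pressure_ge b; rewrite -mueq /free_energy integral_spin_potential => lnZ.
rewrite mulrC -ler_pdivlMr ?ltr0n// -lee_fin EFinB leeBlDr//.
rewrite (le_trans lnZ)// leeD2r// -coordsE.
apply: ks_entropy_le => //.
- exact: measurable_shift.
- exact: measurable_fibers_coord.
move=> r xi mxi eps eps0; have [m [f fE]] := labelling_approx mu mxi eps0.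
by exists m, f; rewrite coordsE.
Qed.

End equilibrium.

(** * The rate function *)

Lemma mean_value (R : realType) (f df : R -> R) : (forall x : R, is_derive x 1 f (df x)) ->
  forall a b, a < b -> exists c, [/\ a < c, c < b & f b - f a = df c * (b - a)].
Proof.
move=> fdf a b ab.
have cf : {within `[a, b], continuous f}.
  by apply: derivable_within_continuous => x _; exact: (@ex_derive _ _ _ _ _ _ _ (fdf x)).
have [c] := MVT ab (fun x _ => fdf x) cf.
by rewrite in_itv /= => /andP[ac cb] fE; exists c.
Qed.

Section tanh.
Context {R : realType}.
Implicit Types x y z : R.

Definition tanh z : R := (expR z - expR (- z)) / (expR z + expR (- z)).

Lemma is_derive_expRN z : is_derive z 1 (fun x : R => expR (- x)) (- expR (- z)).
Proof.
have := @is_derive1_comp R expR -%R z _ _ (is_derive_expR _) (is_deriveNid z 1).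
by rewrite mulrN1.
Qed.

Lemma is_derive_tanh z : is_derive z 1 tanh (1 - tanh z ^+ 2).
Proof.
have d0 := expRDexpRN_gt0 z.
have eN := is_derive_expRN z.
have den := is_deriveD (is_derive_expR z) eN.
have num := is_deriveB (is_derive_expR z) eN.
have inv := @is_deriveV R (expR + (fun x : R => expR (- x))) z _ 1 (lt0r_neq0 d0) den.
have := is_deriveM num inv.
set A := expR z; set B := expR (- z).
suff <- : (A - B) * (- (A + B) ^- 2 * (A - B)) + (A + B)^-1 * (A - - B) = 1 - tanh z ^+ 2 by [].
by rewrite /tanh -/A -/B; field; rewrite gt_eqF.
Qed.

Lemma tanh_sqr_lt1 z : tanh z ^+ 2 < 1.
Proof.
have d0 := expRDexpRN_gt0 z.
rewrite /tanh expr_div_n ltr_pdivrMr ?exprn_gt0// mul1r -subr_gt0.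
rewrite (_ : _ - _ = 4 * (expR z * expR (- z))); last by ring.
by rewrite mulr_gt0// mulr_gt0 ?expR_gt0.
Qed.

Lemma tanh_lt1 z : tanh z < 1.
Proof.
rewrite ltr_pdivrMr ?expRDexpRN_gt0// mul1r.
by rewrite (@lt_trans _ _ (expR z))// ?ltrBlDr ?ltrDl ?expR_gt0.
Qed.

Lemma tanh0 : tanh 0 = 0.
Proof. by rewrite /tanh oppr0 subrr mul0r. Qed.

Lemma tanh_incr x y : x < y -> tanh x < tanh y.
Proof.
move=> xy; have [c [_ _ tE]] := mean_value is_derive_tanh xy.
by rewrite -subr_gt0 tE mulr_gt0 ?subr_gt0// tanh_sqr_lt1.
Qed.

Lemma tanh_gt0 x : 0 < x -> 0 < tanh x.
Proof. by move=> /tanh_incr; rewrite tanh0. Qed.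

Lemma tanh_le_id x : 0 < x -> tanh x <= x.
Proof.
move=> x0; have [c [_ _]] := mean_value is_derive_tanh x0.
by rewrite tanh0 !subr0 => ->; rewrite ger_pMl// gerBl sqr_ge0.
Qed.

(* The slope of a chord from the origin decreases: compare the mean values of
   tanh' = 1 - tanh^2 over [0, x] and [x, y]. *)
Lemma tanh_ratio x y : 0 < x -> x < y -> tanh y * x < tanh x * y.
Proof.
move=> x0 xy; have [c [c0 cx]] := mean_value is_derive_tanh x0.
have [e [xe ey]] := mean_value is_derive_tanh xy.
rewrite tanh0 !subr0 => tE2 tE1.
have tce : 1 - tanh e ^+ 2 < 1 - tanh c ^+ 2.
  have ce := tanh_incr (lt_trans cx xe); have tc := tanh_gt0 c0.
  by rewrite ltrD2l ltrN2 ltr_pXn2r// nnegrE ltW// (lt_trans tc).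
have -> : tanh y = tanh x + (1 - tanh e ^+ 2) * (y - x) by rewrite -tE2; ring.
rewrite tE1 -subr_gt0.
rewrite (_ : _ - _ = ((1 - tanh c ^+ 2) - (1 - tanh e ^+ 2)) * (y - x) * x); last by ring.
by rewrite !mulr_gt0// subr_gt0.
Qed.

End tanh.

Section rate_function.
Context {R : realType}.
Variable beta : R.
Hypothesis beta0 : 0 < beta.
Implicit Types x y : R.

Lemma cosh_gt0 x : 0 < Defs.cosh x :> R.
Proof. by rewrite divr_gt0// expRDexpRN_gt0. Qed.

Lemma coshN x : Defs.cosh (- x) = Defs.cosh x.
Proof. by rewrite /Defs.cosh opprK addrC. Qed.

(** The sign of the derivative is thus read off the mean-field equation [tanh (beta * y) = y]. *)
Lemma is_derive_phi_I y : is_derive y 1 (phi_I beta) (beta * (tanh (beta * y) - y)).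
Proof.
have dM : is_derive y 1 (fun x : R => beta * x) beta.
  by have := is_deriveZ beta (is_derive_id y 1); rewrite /GRing.scale/= mulr1.
have dcosh (z : R) : is_derive z 1 (@Defs.cosh R) ((expR z - expR (- z)) / 2).
  have := is_deriveZ 2^-1 (is_deriveD (is_derive_expR z) (is_derive_expRN z)).
  have -> : 2^-1 \*: (expR + (fun x : R => expR (- x))) = @Defs.cosh R.
    by apply/funext => x; rewrite /Defs.cosh mulrC.
  by rewrite /GRing.scale/= mulrC.
have dln := @is_derive1_comp R _ _ _ _ _ (is_derive1_ln (cosh_gt0 (beta * y))) (dcosh (beta * y)).
have d1 := @is_derive1_comp R _ _ _ _ _ dln dM.
have d2 := is_deriveZ (beta / 2) (is_deriveX 2 (is_derive_id y 1)).
have := is_deriveB d1 d2.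
set A := expR (beta * y); set B := expR (- (beta * y)).
suff <- : ((A + B) / 2)^-1 * ((A - B) / 2) * beta - (beta / 2) * ((2 * y ^+ 1) * 1) =
    beta * (tanh (beta * y) - y) by [].
by rewrite /tanh -/A -/B; field; rewrite gt_eqF// expRDexpRN_gt0.
Qed.

Lemma phi_IN y : phi_I beta (- y) = phi_I beta y.
Proof. by rewrite /phi_I mulrN coshN sqrrN. Qed.

Lemma phi_I_norm y : phi_I beta `|y| = phi_I beta y.
Proof. by case: (ger0P y) => // _; rewrite phi_IN. Qed.

(** On positive [y] the ratio [tanh (beta * y) / y] strictly decreases, so it exceeds 1 up to a
    switching point [xi] and is below 1 afterwards. Taking [xi] as a supremum treats all [beta]
    uniformly. *)
Lemma phi_I_shape : exists xi, [/\ 0 <= xi <= 1, beta <= 1 -> xi = 0,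
  forall x y, 0 <= x -> x < y -> y <= xi -> phi_I beta x < phi_I beta y &
  forall x y, xi <= x -> x < y -> phi_I beta y < phi_I beta x].
Proof.
pose S : set R := [set y | 0 <= y <= 1 /\ (y = 0 \/ y < tanh (beta * y))].
have S0 : S 0 by split; [rewrite lexx ler01|left].
have S1 : ubound S 1 by move=> y [/andP[]].
have supS : has_sup S by split; [exists 0|exists 1].
pose xi := sup S.
have below y : 0 < y -> y < xi -> y < tanh (beta * y).
  move=> y0 yxi; have [s [_ [s0|sS]] ys] := sup_gt (ex_intro _ 0 S0) yxi.
    by move: ys; rewrite s0 ltNge (ltW y0).
  have := @tanh_ratio _ (beta * y) (beta * s); rewrite mulr_gt0// ltr_pM2l// => /(_ isT ys).
  rewrite ![_ * (beta * _)]mulrCA ltr_pM2l// => h.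
  by rewrite -(ltr_pM2r (lt_trans y0 ys)) (le_lt_trans _ h)// mulrC ler_pM2r// ltW.
have above y : xi < y -> tanh (beta * y) < y.
  move=> xiy; have xi0 : 0 <= xi by apply: sup_upper_bound.
  (* Failure of membership in [S] gives only a weak inequality; applying it at a midpoint [z] and
     using the strict decrease of the ratio from [z] to [y] makes it strict at [y]. *)
  have [y1|y1] := leP 1 y; first by rewrite (lt_le_trans (tanh_lt1 _)).
  pose z := (xi + y) / 2.
  have [xiz zy] : xi < z /\ z < y by rewrite /z; split; [rewrite midf_lt|rewrite midf_lt].
  have z0 := le_lt_trans xi0 xiz.
  have : ~ S z by move=> /(sup_upper_bound supS); rewrite leNgt xiz.
  have [zz|zz Sz] := leP (tanh (beta * z)) z; last first.
    by case: Sz; split; [rewrite ltW//= ltW// (lt_trans zy)|right].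
  move=> _; have := @tanh_ratio _ (beta * z) (beta * y); rewrite mulr_gt0// ltr_pM2l// => /(_ isT zy).
  rewrite ![_ * (beta * _)]mulrCA ltr_pM2l// => h.
  by rewrite -(ltr_pM2r z0) (lt_le_trans h)// [leRHS]mulrC ler_pM2r// (lt_trans z0).
exists xi; split.
- apply/andP; split; first exact: sup_upper_bound.
  by apply: ge_sup => //; exists 0.
- move=> beta1; apply/eqP; rewrite eq_le sup_upper_bound// andbT.
  apply: ge_sup; first by exists 0.
  move=> y [/andP[y0 _] [->//|yt]]; rewrite leNgt; apply/negP => yp.
  have := tanh_le_id (mulr_gt0 beta0 yp); rewrite leNgt => /negP[].
  by rewrite (le_lt_trans _ yt)// ger_pMl.
- move=> x y x0 xy yxi; have [c [xc cy E]] := mean_value is_derive_phi_I xy.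
  rewrite -subr_gt0 E !mulr_gt0 ?subr_gt0// below//; first exact: le_lt_trans xc.
  exact: lt_le_trans yxi.
- move=> x y xix xy; have [c [xc cy E]] := mean_value is_derive_phi_I xy.
  rewrite -subr_lt0 E pmulr_llt0 ?subr_gt0// pmulr_rlt0// subr_lt0 above//.
  exact: le_lt_trans xc.
Qed.

(** Monotonicity on both sides separates [phi_I] from its maximum on the whole region far from [xi]
    and [- xi], tails included. *)
Lemma phi_I_gap xi : 0 <= xi ->
  (forall x y, 0 <= x -> x < y -> y <= xi -> phi_I beta x < phi_I beta y) ->
  (forall x y, xi <= x -> x < y -> phi_I beta y < phi_I beta x) ->
  forall delta, 0 < delta -> exists2 eta, 0 < eta &
    forall y, phi_I beta xi - eta < phi_I beta y -> `| `|y| - xi| < delta.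
Proof.
move=> xi0 incr decr delta delta0.
(* If [delta > xi], no [|y|] lies at distance [delta] to the left of [xi], and the value 1 is
   arbitrary. *)
pose etal := if delta <= xi then phi_I beta xi - phi_I beta (xi - delta) else 1.
pose etar := phi_I beta xi - phi_I beta (xi + delta).
have etal0 : 0 < etal.
  rewrite /etal; case: ifP => // dxi; rewrite subr_gt0 incr//.
    by rewrite subr_ge0.
  by rewrite ltrBlDr ltrDl.
have etar0 : 0 < etar by rewrite subr_gt0 decr// ltrDl.
exists (Num.min etal etar); first by rewrite lt_min etal0.
move=> y.
rewrite -(phi_I_norm y); move: `|y| (normr_ge0 y) => {}y y0; apply: contraPT; rewrite -leNgt => dy.
apply/negP; rewrite -leNgt.
have [yxi|xiy] := leP y xi.
  have ydl : y <= xi - delta by move: dy; rewrite ler0_norm ?subr_le0// opprB lerBrDl -lerBrDr.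
  have dxi : delta <= xi by rewrite -subr_ge0 (le_trans y0).
  apply: (@le_trans _ _ (phi_I beta xi - etal)); last by rewrite lerD2l lerN2 ge_min lexx.
  rewrite /etal dxi opprB addrC subrK.
  by move: ydl; rewrite le_eqVlt => /predU1P[->//|yd]; rewrite ltW// incr// gerBl ltW.
have ydr : xi + delta <= y by move: dy; rewrite ger0_norm ?subr_ge0 ?(ltW xiy)// lerBrDl.
apply: (@le_trans _ _ (phi_I beta xi - etar)); last by rewrite lerD2l lerN2 ge_min lexx orbT.
rewrite /etar opprB addrC subrK.
by move: ydr; rewrite le_eqVlt => /predU1P[->//|yd]; rewrite ltW// decr// lerDl ltW.
Qed.

Lemma phi_I_maximizer xi : 0 <= xi <= 1 ->
  (forall x y, 0 <= x -> x < y -> y <= xi -> phi_I beta x < phi_I beta y) ->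
  (forall x y, xi <= x -> x < y -> phi_I beta y < phi_I beta x) ->
  unique (is_maximizer `[0, 1] (phi_I beta)) xi.
Proof.
move=> xi01 incr decr.
have max y : 0 <= y -> y != xi -> phi_I beta y < phi_I beta xi.
  by move=> y0; rewrite neq_lt => /orP[?|?]; [exact: incr|exact: decr].
split; first split.
- by rewrite /= in_itv.
- move=> y; rewrite /= in_itv/= => /andP[y0 _].
  by have [->//|yxi] := eqVneq y xi; rewrite ltW// max.
move=> y [/=]; rewrite in_itv/= => /andP[y0 _] /(_ xi); rewrite /= in_itv/= => /(_ xi01).
by apply: contraPP => /eqP; rewrite eq_sym => /max -/(_ y0); rewrite ltNge => /negP.
Qed.

Lemma expR_phi_I y : expR (phi_I beta y) = Defs.cosh (beta * y) * expR (- (beta / 2 * y ^+ 2)).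
Proof. by rewrite /phi_I expRD lnK// posrE cosh_gt0. Qed.

Lemma continuous_phi_I : continuous (phi_I beta).
Proof.
move=> y; apply: differentiable_continuous; apply/derivable1_diffP.
exact: (@ex_derive _ _ _ _ _ _ _ (is_derive_phi_I y)).
Qed.

End rate_function.

(** * The Curie-Weiss model *)

Section real_integrable.
Context d (T : measurableType d) (R : realType) (m : {measure set T -> \bar R}).

Lemma integrableZl_EFin (c : R) (f : T -> R) : m.-integrable setT (EFin \o f) ->
  m.-integrable setT (EFin \o (fun x => c * f x)).
Proof. by move=> /(integrableZl measurableT c). Qed.

Lemma integrableD_EFin (f g : T -> R) : m.-integrable setT (EFin \o f) ->
  m.-integrable setT (EFin \o g) -> m.-integrable setT (EFin \o (fun x => f x + g x)).
Proof. by move=> fi gi; exact: (integrableD measurableT fi gi). Qed.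

End real_integrable.

(** * Laplace's method for powers of a function *)

Section laplace.
Context {R : realType}.
Local Notation mu := (@lebesgue_measure R).
Implicit Types (f g h E : R -> R).

Lemma dominated_integrable f g : measurable_fun setT f -> (forall x, `|f x| <= g x) ->
  mu.-integrable setT (EFin \o g) -> mu.-integrable setT (EFin \o f).
Proof.
move=> mf fg; apply: le_integrable => //; first exact/measurable_EFinP.
by move=> x _; rewrite /= lee_fin (le_trans (fg x))// ler_norm.
Qed.

(** The condition on [h] concerns superlevel sets of [E] rather than neighbourhoods of [xi], which
    allows several maximizers sharing the value [h0]. The exponent [n.+1] leaves a factor [E] that
    ensures integrability. *)
Lemma laplace_concentration E h (xi h0 : R) : continuous E -> (forall x, 0 <= E x <= E xi) ->
  0 < E xi -> mu.-integrable setT (EFin \o E) ->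
  measurable_fun setT h -> (forall x, `|h x - h0| <= 1) ->
  (forall eps, 0 < eps -> exists2 eta, 0 < eta &
    forall x, E xi - eta < E x -> `|h x - h0| <= eps) ->
  (\int[mu]_x (h x * E x ^+ n.+1)) / (\int[mu]_x (E x ^+ n.+1)) @[n --> \oo] --> h0.
Proof.
move=> cE E01 M0 iE mh h1 hloc; set M := E xi in E01 M0 hloc *.
have E0 x : 0 <= E x by case/andP: (E01 x).
have mE : measurable_fun setT E by exact: continuous_measurable_fun.
have mEn n : measurable_fun setT (fun x => E x ^+ n) by exact: measurable_funX.
have iEn n : mu.-integrable setT (EFin \o (fun x => E x ^+ n.+1)).
  apply: (@dominated_integrable _ (fun x => M ^+ n * E x)) => // [x|].
    rewrite ger0_norm ?exprn_ge0// exprSr ler_wpM2r// lerXn2r ?nnegrE// ?(ltW M0)//.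
    by case/andP: (E01 x).
  exact: integrableZl_EFin.
have idh n : mu.-integrable setT (EFin \o (fun x => (h x - h0) * E x ^+ n.+1)).
  apply: (dominated_integrable _ _ (iEn n)) => [|x].
    by apply: measurable_funM => //; exact: measurable_funB.
  by rewrite normrM [X in _ * X]ger0_norm ?exprn_ge0// ler_piMl// exprn_ge0.
have ih n : mu.-integrable setT (EFin \o (fun x => h0 * E x ^+ n.+1)).
  exact: integrableZl_EFin.
(* By continuity [E] stays above [M - e] on an interval of positive length at [xi]. *)
have lower e : 0 < e < M -> exists2 d, 0 < d &
    forall n, d * (M - e) ^+ n.+1 <= \int[mu]_x (E x ^+ n.+1).
  move=> /andP[e0 eM].
  have /cvgrPdist_le/(_ _ e0)/nbhs_ballP[d /= d0 dE] := cE xi.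
  have d20 : 0 < d / 2 by rewrite divr_gt0.
  pose I : set R := [set` `[xi, xi + d / 2]].
  have mI : measurable I by exact: measurable_itv.
  have muI : mu I = (d / 2)%:E.
    by rewrite lebesgue_measure_itv/= lte_fin ltrDl d20 -EFinB addrAC subrr add0r.
  exists (d / 2) => // n.
  rewrite -[d / 2]/(fine (d / 2)%:E) -muI mulrC -Rintegral_cst//.
  rewrite Rintegral_mkcond patch_indic.
  apply: le_Rintegral => //.
    rewrite (_ : _ \* _ = (fun x => (M - e) ^+ n.+1 * \1_I x))//.
    by apply: integrableZl_EFin; exact: integrable_indic_itv.
  move=> x _; rewrite /= indicE; case: (boolP (x \in I)) => [/set_mem|_]; last first.
    by rewrite mulr0 exprn_ge0.
  rewrite mulr1.
  rewrite /I /= in_itv/= => /andP[xix xd].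
  rewrite lerXn2r ?nnegrE ?subr_ge0 ?(ltW eM)//.
  have : `|M - E x| <= e.
    apply: dE; rewrite /ball/= ler0_norm ?subr_le0// opprB ltrBlDl (le_lt_trans xd)//.
    by rewrite ltrD2l ltr_pdivrMr// ltr_pMr// ltr1n.
  by move=> /(le_trans (ler_norm _)); rewrite lerBlDr lerBlDl addrC.
apply/cvgrPdist_le => eps eps0.
have eps20 : 0 < eps / 2 by rewrite divr_gt0.
have [eta0 eta00 etaP] := hloc _ eps20.
pose eta := Num.min eta0 (M / 2).
have eta_gt0 : 0 < eta by rewrite lt_min eta00 divr_gt0.
have etaM : eta < M by rewrite gt_min ltr_pdivrMr// ltr_pMr// ltr1n orbT.
have [d d0 dP] : exists2 d, 0 < d & forall n, d * (M - eta / 2) ^+ n.+1 <= \int[mu]_x (E x ^+ n.+1).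
  apply: lower; rewrite divr_gt0//= (lt_trans _ etaM)//.
  by rewrite ltr_pdivrMr// ltr_pMr// ltr1n.
(* Points with [E x <= s] contribute at most [s ^+ n * A], while the denominator is at least
   [d * t ^+ n.+1] with [s < t], so their share decays geometrically. *)
pose s := M - eta; pose t := M - eta / 2.
have s0 : 0 < s by rewrite subr_gt0.
have st : s < t by rewrite ltrD2l ltrN2 ltr_pdivrMr// ltr_pMr// ltr1n.
have t0 := lt_trans s0 st.
set A := \int[mu]_x E x.
have A0 : 0 <= A by apply: Rintegral_ge0.
have diff n : `|\int[mu]_x ((h x - h0) * E x ^+ n.+1)| <=
    eps / 2 * \int[mu]_x (E x ^+ n.+1) + s ^+ n * A.
  rewrite (le_trans (le_normr_Rintegral _ (idh n)))//.
  rewrite -RintegralZl// -RintegralZl// -RintegralD//; first last.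
  - exact: integrableZl_EFin.
  - exact: integrableZl_EFin.
  apply: le_Rintegral => //.
  - exact: (integrable_abse (idh n)).
  - by apply: integrableD_EFin; exact: integrableZl_EFin.
  move=> x _; rewrite normrM [X in _ * X]ger0_norm ?exprn_ge0//.
  have [Ex|Ex] := ltP s (E x).
    rewrite (le_trans (ler_wpM2r _ (etaP x _)))// ?exprn_ge0//.
      by rewrite (le_lt_trans _ Ex)// lerD2l lerN2 ge_min lexx.
    by rewrite lerDl mulr_ge0// exprn_ge0// ltW.
  rewrite (@le_trans _ _ (E x ^+ n.+1))//; first by rewrite ler_piMl// exprn_ge0.
  rewrite (@le_trans _ _ (s ^+ n * E x))//.
    by rewrite exprSr ler_wpM2r// lerXn2r ?nnegrE// ltW.
  by rewrite lerDr mulr_ge0 ?exprn_ge0// ltW.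
have rlt1 : `|s / t| < 1 by rewrite ger0_norm ?divr_ge0 ?ltW// ltr_pdivrMr// mul1r.
have /cvgrPdist_le/(_ _ eps20) := cvg_geometric (A / (d * t)) rlt1.
apply: filterS => n; rewrite sub0r normrN => geo.
set a := \int[mu]_x (E x ^+ n.+1) in dP *.
have a0 : 0 < a by apply: lt_le_trans (dP n); rewrite mulr_gt0// exprn_gt0.
rewrite (_ : h0 - _ = - (\int[mu]_x ((h x - h0) * E x ^+ n.+1) / a)); last first.
  have -> : \int[mu]_x (h x * E x ^+ n.+1) = \int[mu]_x ((h x - h0) * E x ^+ n.+1) + h0 * a.
    rewrite -RintegralZl// -RintegralD//; first by apply: eq_Rintegral => x _; rewrite -mulrDl subrK.
  by field; rewrite gt_eqF.
rewrite normrN normrM normfV (gtr0_norm a0) ler_pdivrMr// (le_trans (diff n))//.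
rewrite [leRHS](_ : _ = eps / 2 * a + eps / 2 * a); last by field.
rewrite lerD2l (@le_trans _ _ (eps / 2 * (d * t ^+ n.+1)))//; last by rewrite ler_pM2l// dP.
rewrite -ler_pdivrMr ?mulr_gt0 ?exprn_gt0//.
apply: le_trans geo; apply: le_trans (ler_norm _).
rewrite /geometric/= expr_div_n exprS le_eqVlt; apply/orP; left; apply/eqP.
by field; rewrite expf_neq0 !gt_eqF.
Qed.

End laplace.

Section curie_weiss.
Context {R : realType}.
Local Notation mu := (@lebesgue_measure R).

(** Completing the square: [K] is a multiple of the normal density with mean [b / c] and variance
    [1 / c]. *)
Lemma gaussian_laplace (c b : R) : 0 < c ->
  let K := fun y : R => expR (- (c / 2 * y ^+ 2)) * expR (b * y) in
  mu.-integrable setT (EFin \o K) /\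
  \int[mu]_y K y = expR (b ^+ 2 / (2 * c)) / normal_peak (Num.sqrt c^-1).
Proof.
move=> c0 K; set sigma := Num.sqrt c^-1; set m := b / c.
have c_neq0 : c != 0 by rewrite gt_eqF.
have sE : sigma ^+ 2 = c^-1 by rewrite sqr_sqrtr// invr_ge0 ltW.
have s0 : sigma != 0 by rewrite gt_eqF// sqrtr_gt0 invr_gt0.
have p0 : normal_peak sigma != 0 by rewrite gt_eqF// normal_peak_gt0.
have -> : K = fun y => expR (b ^+ 2 / (2 * c)) / normal_peak sigma * normal_pdf m sigma y.
  apply/funext => y; rewrite normal_pdfE// mulrA divfK// /normal_fun sE /K -!expRD.
  by congr expR; rewrite /m; field.
have ip := @integrable_normal_pdf R m sigma.
split; first exact: integrableZl_EFin.
rewrite RintegralZl// /Rintegral [X in fine X](_ : _ = 1%E) ?mulr1//.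
exact: integral_normal_pdf.
Qed.

Lemma Rintegral_sum d (T : measurableType d) (m : {measure set T -> \bar R})
    (I : Type) (r : seq I) (P : pred I) (f : I -> T -> R) :
  (forall i, m.-integrable setT (EFin \o f i)) ->
  m.-integrable setT (EFin \o (fun x => \sum_(i <- r | P i) f i x)) /\
  \int[m]_x (\sum_(i <- r | P i) f i x) = \sum_(i <- r | P i) \int[m]_x f i x.
Proof.
move=> fi; elim: r => [|i r [IHi IHr]].
  rewrite (_ : (fun x => _) = cst 0); last by apply/funext => x; rewrite big_nil.
  split; first by rewrite (_ : _ \o _ = cst 0%E)//; exact: integrable0.
  by rewrite big_nil /Rintegral integral0.
rewrite big_cons; case: ifPn => Pi.
  rewrite (_ : (fun x => _) = (fun x => f i x + \sum_(j <- r | P j) f j x)); last first.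
    by apply/funext => x; rewrite big_cons Pi.
  by split; [exact: integrableD_EFin|rewrite RintegralD// IHr].
rewrite (_ : (fun x => _) = (fun x => \sum_(j <- r | P j) f j x))//.
by apply/funext => x; rewrite big_cons (negbTE Pi).
Qed.

(** Consistency of the Bernoulli weights, read off the measure: both sides are the law of its first
    [k] letters. *)
Lemma sum_gibbs_word_prefix (b : R) k n (kn : (k <= n)%N) (u : k.-tuple bool) :
  \sum_(v : n.-tuple bool | word_prefix kn v == u) gibbs_word b v = gibbs_word b u.
Proof.
have [nu [_ nuE]] := bernoulli_invariant b.
rewrite -nuE -(word_prefix_coords kn) law_comp; last exact: measurable_coords.
by apply: eq_bigr => v _; rewrite nuE.
Qed.

Variable beta : R.
Hypothesis beta0 : 0 < beta.

Definition word_weight n (v : n.-tuple bool) : R :=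
  expR (beta / (2 * n%:R) * spin_sum v ^+ 2).

Lemma word_weight_gt0 n (v : n.-tuple bool) : 0 < word_weight v.
Proof. exact: expR_gt0. Qed.

Lemma total_word_weight_gt0 n : 0 < \sum_(v : n.-tuple bool) word_weight v.
Proof.
rewrite (bigD1 [tuple true | i < n])//= ltr_pwDl ?word_weight_gt0// sumr_ge0// => v _.
exact/ltW/word_weight_gt0.
Qed.

Lemma cw_energyE n (v : n.-tuple bool) :
  expR (- beta * cw_energy (tnth v)) = word_weight v.
Proof.
congr expR; rewrite /cw_energy mulrA mulrNN /spin_sum big_tuple; congr (_ * _).
by rewrite expr2 mulr_suml; apply: eq_bigr => i _; rewrite mulr_sumr.
Qed.

(* The average over both orientations of the mean field: being even in [y], it
   takes the same value at the two maximizers of [phi_I]. *)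
Definition field_word k (u : k.-tuple bool) (y : R) : R :=
  (gibbs_word (beta * y) u + gibbs_word (- (beta * y)) u) / 2.

(** The Gaussian identity is used with [c = n beta] and [b = beta * spin_sum v]. The prefactor
    depends on neither [k] nor [u], so it cancels in quotients. *)
Lemma sum_word_weight k n (kn : (k <= n)%N) (u : k.-tuple bool) : (0 < n)%N ->
  \sum_(v : n.-tuple bool | word_prefix kn v == u) word_weight v =
  normal_peak (Num.sqrt (n%:R * beta)^-1) * 2 ^+ n *
    \int[mu]_y (field_word u y * expR (phi_I beta y) ^+ n).
Proof.
move=> n0; have nR : (0 : R) < n%:R by rewrite ltr0n.
set c := n%:R * beta; have c0 : 0 < c by rewrite mulr_gt0.
set w := normal_peak _.
have w0 : w != 0 by rewrite gt_eqF// normal_peak_gt0// gt_eqF// sqrtr_gt0 invr_gt0.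
pose K b := fun y : R => expR (- (c / 2 * y ^+ 2)) * expR (b * y).
(* Only [b ^+ 2] enters the value of the Gaussian integral, so averaging over [b] and [- b] is free;
   it makes the integrand even and produces [field_word]. *)
pose G (v : n.-tuple bool) := fun y => 2^-1 * (K (beta * spin_sum v) y + K (- (beta * spin_sum v)) y).
have GP v : mu.-integrable setT (EFin \o G v) /\ word_weight v = w * \int[mu]_y G v y.
  have [i1 e1] := gaussian_laplace (beta * spin_sum v) c0.
  have [i2 e2] := gaussian_laplace (- (beta * spin_sum v)) c0.
  split; first by apply: integrableZl_EFin; exact: integrableD_EFin.
  rewrite RintegralZl//; last exact: integrableD_EFin.
  rewrite RintegralD// e1 e2 sqrrN -/w.
  rewrite (_ : word_weight v = expR ((beta * spin_sum v) ^+ 2 / (2 * c))).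
    by field.
  by congr expR; rewrite /c; field; rewrite !gt_eqF.
under eq_bigr do rewrite (GP _).2.
rewrite -mulr_sumr -mulrA; congr (w * _).
have [iS <-] := Rintegral_sum (index_enum _) (fun v => word_prefix kn v == u) (fun v => (GP v).1).
have sumE (b : R) : \sum_(v : n.-tuple bool | word_prefix kn v == u) expR (b * spin_sum v) =
    gibbs_word b u * (expR b + expR (- b)) ^+ n.
  rewrite -(sum_gibbs_word_prefix b kn u) mulr_suml; apply: eq_bigr => v _.
  by rewrite gibbs_wordE size_tuple divfK// expf_neq0// gt_eqF// expRDexpRN_gt0.
(* The powers of [e^(beta y) + e^(- beta y)] released by the Bernoulli weights combine with the
   Gaussian factor into [2^n e^(n phi_I)]. *)
have GE y : \sum_(v : n.-tuple bool | word_prefix kn v == u) G v y =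
    2 ^+ n * (field_word u y * expR (phi_I beta y) ^+ n).
  rewrite -mulr_sumr big_split/= -!mulr_sumr.
  have -> : \sum_(v : n.-tuple bool | word_prefix kn v == u) expR (beta * spin_sum v * y) =
      gibbs_word (beta * y) u * (expR (beta * y) + expR (- (beta * y))) ^+ n.
    by rewrite -sumE; apply: eq_bigr => v _; congr expR; ring.
  have -> : \sum_(v : n.-tuple bool | word_prefix kn v == u) expR (- (beta * spin_sum v) * y) =
      gibbs_word (- (beta * y)) u * (expR (beta * y) + expR (- (beta * y))) ^+ n.
    have := sumE (- (beta * y)); rewrite opprK [expR (- _) + _]addrC => <-.
    by apply: eq_bigr => v _; congr expR; ring.
  have -> : expR (phi_I beta y) ^+ n = expR (- (c / 2 * y ^+ 2)) *
      (expR (beta * y) + expR (- (beta * y))) ^+ n / 2 ^+ n.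
    rewrite expR_phi_I exprMn /Defs.cosh expr_div_n mulrC mulrA; congr (_ * _ / _).
    by rewrite -expRM_natl; congr expR; rewrite /c; ring.
  by rewrite /field_word; field; rewrite expf_neq0.
under eq_Rintegral do rewrite GE.
rewrite RintegralZl//.
have := integrableZl_EFin (2 ^- n) iS.
rewrite (_ : (fun y => _) = (fun y => field_word u y * expR (phi_I beta y) ^+ n))//.
by apply/funext => y; rewrite GE mulKf// expf_neq0.
Qed.

Lemma power_measure_word (P : probability (Sigma2 R) R) n (v : n.-tuple bool) :
  is_power_measure (fair_coin R) P -> P (coords n @^-1` [set v]) = (2 ^- n)%:E.
Proof.
move=> hP; rewrite -cylinderE; have := hP n (fun i => [set tnth v i]).
rewrite (_ : [set x | _] = cylinder v)// => ->.
have half (b : bool) : fair_coin R [set b] = (2^-1)%:E.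
  rewrite /fair_coin /= bernoulli_probE; last first.
    by rewrite invr_ge0 ler0n/= invf_le1// ler1n.
  rewrite !diracE; case: b; [rewrite mem_set// memNset//|rewrite memNset// mem_set//].
    by rewrite mule1 mule0 adde0.
  by rewrite mule0 mule1 add0e; congr (_%:E); rewrite /unstable.onem; field.
under eq_bigr do rewrite half.
rewrite -exprVn -[in RHS](card_ord n) -prodr_const.
by elim/big_rec2 : _ => // i x y _ ->.
Qed.

(** The density depends on the first [n] letters only, and the mass [2^-n] of each word cancels
    against the same factor in the partition function. *)
Lemma cw_gibbs_word (P : probability (Sigma2 R) R) k n (kn : (k <= n)%N) (u : k.-tuple bool) :
  is_power_measure (fair_coin R) P ->
  cw_gibbs P beta n (coords k @^-1` [set u]) =
  ((\sum_(v : n.-tuple bool | word_prefix kn v == u) word_weight v) /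
   (\sum_(v : n.-tuple bool) word_weight v))%:E.
Proof.
move=> hP; set Z := (X in _ / X).
have Z0 : 0 < Z by exact: total_word_weight_gt0.
have partE : cw_partition beta n = 2 ^- n * Z.
  by rewrite /cw_partition; congr (_ * _); apply: eq_bigr => v _; exact: cw_energyE.
have densE x : cw_density beta n x = word_weight (coords n x) / (2 ^- n * Z).
  rewrite /cw_density partE -cw_energyE; congr (expR (_ * cw_energy _) / _).
  by apply/funext => i; rewrite tnth_mktuple.
rewrite /cw_gibbs integral_mkcond.
pose g (v : n.-tuple bool) : R := if word_prefix kn v == u then word_weight v / (2 ^- n * Z) else 0.
rewrite (_ : _ \_ _ = (fun x => (g (coords n x))%:E)); last first.
  apply/funext => x; rewrite /patch /g -(word_prefix_coords kn) /=.
  case: ifPn => [/set_mem/= ->|]; first by rewrite eqxx densE.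
  by move=> /negP xu; case: eqP => // e; case: xu; exact/mem_set.
have Poo : (P setT < +oo)%E by rewrite probability_setT ltey.
rewrite (integral_labelling g Poo (@measurable_coords _ n)).
rewrite (eq_bigr (fun v => (g v * 2 ^- n)%:E)); last first.
  by move=> v _; rewrite EFinM; congr (_ * _)%E; exact: power_measure_word.
rewrite sumEFin; congr (_%:E); rewrite /g mulr_suml [RHS]big_mkcond/=.
apply: eq_bigr => v _; case: ifP => _; last by rewrite mul0r.
by field; rewrite expf_neq0//= gt_eqF.
Qed.

Lemma continuous_gibbs_word (w : seq bool) : continuous (fun b : R => gibbs_word b w).
Proof.
have cexp (f : R -> R) : continuous f -> continuous (fun b => expR (f b)).
  by move=> cf b; apply: continuous_comp; [exact: cf|exact: continuous_expR].
have cN : continuous (fun b : R => expR (- b)) by apply: cexp; exact: oppr_continuous.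
have cletter a : continuous (fun b : R => gibbs_letter b a).
  move=> b; apply: cvgM.
    by apply: (cexp (fun b => b * spin a)) => x; exact: mulrr_continuous.
  apply: cvgV; first by rewrite gt_eqF// expRDexpRN_gt0.
  by apply: cvgD; [exact: continuous_expR|exact: cN].
move=> b; apply: cvg_big => [|a _]; first exact: mul_continuous.
exact: cletter.
Qed.

Lemma gibbs_word_le1 (b : R) (w : seq bool) : gibbs_word b w <= 1.
Proof.
apply: prodr_ile1 => a _; rewrite ltW ?gibbs_letter_gt0//=.
have /andP[_ t1] := gibbs_letter_itv b.
by case: a; rewrite ?gibbs_letterN ?ltW// ltrBlDr ltrDl gibbs_letter_gt0.
Qed.

Lemma field_word_itv k (u : k.-tuple bool) y : 0 <= field_word u y <= 1.
Proof.
have p1 := gibbs_word_gt0 (beta * y) u; have p2 := gibbs_word_gt0 (- (beta * y)) u.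
have l1 := gibbs_word_le1 (beta * y) u; have l2 := gibbs_word_le1 (- (beta * y)) u.
by rewrite /field_word; apply/andP; split; lra.
Qed.

Lemma field_wordN k (u : k.-tuple bool) y : field_word u (- y) = field_word u y.
Proof. by rewrite /field_word mulrN opprK addrC. Qed.

Lemma continuous_field_word k (u : k.-tuple bool) : continuous (field_word u).
Proof.
have cM : continuous (fun y : R => beta * y) by exact: mulrl_continuous.
move=> y; apply: cvgM; last exact: cvg_cst.
apply: cvgD; first exact: (continuous_comp (cM y) (@continuous_gibbs_word u _)).
apply: (@continuous_comp _ _ _ (fun y => - (beta * y)) (fun b => gibbs_word b u)).
  by apply: cvgN; exact: cM.
exact: continuous_gibbs_word.
Qed.

Lemma integrable_expR_phi_I : mu.-integrable setT (EFin \o (fun y => expR (phi_I beta y))).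
Proof.
have [i1 _] := gaussian_laplace beta beta0; have [i2 _] := gaussian_laplace (- beta) beta0.
have := integrableZl_EFin 2^-1 (integrableD_EFin i1 i2).
rewrite (_ : (fun y => _) = (fun y => expR (phi_I beta y)))//.
apply/funext => y; rewrite expR_phi_I /Defs.cosh mulNr.
by field.
Qed.

Lemma cw_gibbs_word_cvg (P : probability (Sigma2 R) R) (xi : R) k (u : k.-tuple bool) :
  is_power_measure (fair_coin R) P -> 0 <= xi <= 1 ->
  (forall x y, 0 <= x -> x < y -> y <= xi -> phi_I beta x < phi_I beta y) ->
  (forall x y, xi <= x -> x < y -> phi_I beta y < phi_I beta x) ->
  fine (cw_gibbs P beta n (coords k @^-1` [set u])) @[n --> \oo] --> field_word u xi.
Proof.
move=> hP xi01 incr decr; have xi0 : 0 <= xi by case/andP: xi01.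
have phi_max y : phi_I beta y <= phi_I beta xi.
  rewrite -(phi_I_norm beta y); have [<-//|] := eqVneq `|y| xi.
  rewrite neq_lt => /orP[yx|xy]; apply/ltW; first exact: incr.
  exact: decr.
pose E y := expR (phi_I beta y).
have cE : continuous E.
  move=> y; apply: continuous_comp; last exact: continuous_expR.
  exact: continuous_phi_I.
have local eps : 0 < eps -> exists2 eta, 0 < eta &
    forall y, E xi - eta < E y -> `|field_word u y - field_word u xi| <= eps.
  move=> eps0; have /cvgrPdist_le/(_ _ eps0)/nbhs_ballP[d /= d0 dP] := @continuous_field_word _ u xi.
  have [eta eta0 etaP] := phi_I_gap xi0 incr decr d0.
  (* This choice turns a superlevel set of [E] into the superlevel set of [phi_I] at height
     [phi_I beta xi - eta]. *)
  exists (E xi - expR (phi_I beta xi - eta)).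
    by rewrite subr_gt0 ltr_expR gtrBl.
  move=> y; rewrite opprB addrC subrK ltr_expR => /etaP yd.
  (* The gap controls only [|y|]; evenness covers the peak at [- xi]. *)
  have -> : field_word u y = field_word u `|y|.
    by case: (ger0P y) => // _; rewrite field_wordN.
  by rewrite distrC; apply: dP; rewrite /ball/= distrC.
have := @laplace_concentration R E (field_word u) xi (field_word u xi) cE _ (expR_gt0 _)
  integrable_expR_phi_I (continuous_measurable_fun (@continuous_field_word _ u)) _ local.
move=> /(_ (fun y => _) (fun y => _)) => lap.
rewrite -cvg_shiftS; apply: cvg_trans (lap _ _); last 2 first.
- by move=> y; rewrite expR_ge0/= ler_expR.
- move=> y; have /andP[a0 a1] := field_word_itv u y; have /andP[b0 b1] := field_word_itv u xi.
  by rewrite ler_norml; apply/andP; split; lra.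
apply: near_eq_cvg; near=> n.
have kn : (k <= n.+1)%N by rewrite ltnW// ltnS; near: n; exact: nbhs_infty_ge.
rewrite /= (cw_gibbs_word kn u hP) /= sum_word_weight//.
(* The total weight is the case of the empty prefix, where [field_word] is constantly 1. *)
have -> : \sum_(v : n.+1.-tuple bool) word_weight v =
    \sum_(v : n.+1.-tuple bool | word_prefix (leq0n n.+1) v == [tuple]) word_weight v.
  by apply: eq_bigl => v; rewrite [word_prefix _ _]tuple0 eqxx.
rewrite sum_word_weight//.
have -> : \int[mu]_y (field_word [tuple] y * expR (phi_I beta y) ^+ n.+1) = \int[mu]_y (E y ^+ n.+1).
  apply: eq_Rintegral => y _; rewrite /field_word /gibbs_word !big_nil.
  by rewrite -[1 + 1]/2 divff// mul1r.
set w := normal_peak _; have w0 : w != 0.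
  by rewrite gt_eqF// normal_peak_gt0// gt_eqF// sqrtr_gt0 invr_gt0 mulr_gt0// ltr0n.
by rewrite -mulf_div divff ?mul1r// mulf_neq0// expf_neq0.
Unshelve. all: by end_near.
Qed.

End curie_weiss.

Theorem theorem1 (R : realType)
  (P : probability (Sigma2 R) R) (hP : is_power_measure (fair_coin R) P)
  (mut : R -> probability (Sigma2 R) R)
  (hmut : forall b : R, dynamical_gibbs (spin_potential b) (mut b))
  (beta : R) (hbeta : 0 < beta) :
  exists xi : R,
    unique (is_maximizer `[0, 1] (phi_I beta)) xi /\
    (beta <= 1 -> weak_cvg (cw_gibbs P beta) (mut 0)) /\
    (1 < beta ->
      weak_cvg (cw_gibbs P beta)
        (mscale (2^-1)%:nng
          (measure_add (mut (beta * xi)) (mut (- (beta * xi)))))).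
Proof.
have [xi [xi01 xi_eq0 incr decr]] := phi_I_shape hbeta.
exists xi; split; first exact: phi_I_maximizer.
have cw_cvg k (u : k.-tuple bool) := cw_gibbs_word_cvg hbeta (u := u) hP xi01 incr decr.
have cw1 n : cw_gibbs P beta n setT = 1%E.
  have <- : coords 0 @^-1` [set [tuple]] = [set: Sigma2 R].
    by apply/seteqP; split => // x _; exact: tuple0.
  rewrite (cw_gibbs_word beta (leq0n n) _ hP); congr (_%:E).
  rewrite (eq_bigl xpredT) => [|v]; last by rewrite [word_prefix _ _]tuple0 eqxx.
  by rewrite divff// gt_eqF// total_word_weight_gt0.
have mixE A : mscale (2^-1)%:nng (measure_add (mut (beta * xi)) (mut (- (beta * xi)))) A =
    ((2^-1)%:E * (mut (beta * xi)%R A + mut (- (beta * xi))%R A))%E.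
  by rewrite [LHS]/mscale; congr (_ * _)%E; exact: measure_addE.
split=> [beta1|beta1]; apply: weak_cvg_coords => //.
- exact: probability_setT.
- move=> k u; rewrite (dynamical_gibbs_coords u (hmut 0)).
  (* At [xi = 0] the two orientations coincide and the average collapses to the weight for
     [b = 0]. *)
  have := cw_cvg k u; rewrite xi_eq0// /field_word mulr0 oppr0.
  by rewrite (_ : (_ + _) / 2 = gibbs_word 0 u)//; field.
- rewrite [LHS]mixE !probability_setT -EFinD -EFinM.
  by congr (_%:E); field.
move=> k u; rewrite [X in fine X]mixE.
rewrite -(fineK (fin_num_measure (mut (beta * xi)) _ (measurable_coords u))).
rewrite -(fineK (fin_num_measure (mut (- (beta * xi))) _ (measurable_coords u))).
rewrite (dynamical_gibbs_coords u (hmut _)) (dynamical_gibbs_coords u (hmut _)) /=.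
by rewrite mulrC; exact: cw_cvg.
Qed.
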